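(* There is no existential and no universal $\mathcal{L}_{\rm ring}$-formula $\varphi(x)$ (without parameters) such that $\mathbb{Z}_p=\varphi(\mathbb{Q}_p)$ for all primes $p$. More generally, for any $N>0$ there is no existential and no universal $\mathcal{L}_{\rm ring}$-formula $\varphi(x)$ such that $\mathbb{Z}_p=\varphi(\mathbb{Q}_p)$ for all primes $p\geq N$.
   Context: $\mathcal{L}_{\rm ring}=(+,-,\cdot,0,1)$ is the language of rings. An existential (resp. universal) formula is one of the form $\exists \bar y\,\psi$ (resp. $\forall \bar y\,\psi$) with $\psi$ quantifier-free. $\varphi(\mathbb{Q}_p)$ denotes the set of elements of $\mathbb{Q}_p$ satisfying $\varphi$. *)

(* Defs.v *)
From HB Require Import structures.
From mathcomp Require Export all_boot all_order all_algebra.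
From mathcomp Require Export boolp classical_sets.

Set Implicit Arguments.
Unset Strict Implicit.
Unset Printing Implicit Defensive.

Import GRing.Theory.
Local Open Scope ring_scope.

(* First-order formulas of the language of rings (+, -, *, 0, 1), in           *)
(* well-scoped de Bruijn form: [formula n] has its free variables among        *)
(* 0, ..., n - 1, and a quantifier over [formula n.+1] binds variable 0 and    *)
(* shifts the others, so that an element of [formula 1] is a parameter-free    *)
(* formula in one free variable.                                               *)

Inductive term (n : nat) : Type :=
| TVar of 'I_n
| TZero
| TOne
| TOpp of term n
| TAdd of term n & term n
| TMul of term n & term n.

Inductive formula : nat -> Type :=
| FEq n of term n & term n : formula n
| FNot n of formula n : formula n
| FAnd n of formula n & formula n : formula n
| FOr n of formula n & formula n : formula n
| FEx n of formula n.+1 : formula n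
| FAll n of formula n.+1 : formula n.

Fixpoint quantifier_free n (f : formula n) : bool :=
  match f with
  | FEq _ _ _ => true
  | FNot _ g => quantifier_free g
  | FAnd _ g h => quantifier_free g && quantifier_free h
  | FOr _ g h => quantifier_free g && quantifier_free h
  | FEx _ _ => false
  | FAll _ _ => false
  end.

Fixpoint existential n (f : formula n) : bool :=
  match f with
  | FEx _ g => existential g
  | g => quantifier_free g
  end.

Fixpoint universal n (f : formula n) : bool :=
  match f with
  | FAll _ g => universal g
  | g => quantifier_free g
  end.

Fixpoint teval (K : nzRingType) n (e : n.-tuple K) (t : term n) : K :=
  match t with
  | TVar i => tnth e i
  | TZero => 0
  | TOne => 1
  | TOpp u => - teval e u
  | TAdd u v => teval e u + teval e v
  | TMul u v => teval e u * teval e v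
  end.

Fixpoint holds (K : nzRingType) n (f : formula n) : n.-tuple K -> Prop :=
  match f with
  | FEq _ t u => fun e => teval e t = teval e u
  | FNot _ g => fun e => ~ holds g e
  | FAnd _ g h => fun e => holds g e /\ holds h e
  | FOr _ g h => fun e => holds g e \/ holds h e
  | FEx _ g => fun e => exists x : K, holds g [tuple of x :: e]
  | FAll _ g => fun e => forall x : K, holds g [tuple of x :: e]
  end.

Definition defined_set (K : nzRingType) (f : formula 1) : set K :=
  [set x | holds f [tuple x]]%classic.
Arguments defined_set K f : clear implicits.

Record prime_nat : Type := PrimeNat {
  prime_nat_val :> nat;
  prime_natP : prime prime_nat_val
}.

(* The inverse limit of Z/p <- Z/p^2 <- Z/p^3 <- ...; the exponents start at 1 *)
(* because 'Z_1 is not the trivial ring.                                       *)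
Record padic_int (p : prime_nat) : Type := PadicInt {
  padic_coord : forall n, 'Z_(p ^ n.+1);
  padic_coherent : forall n, (padic_coord n.+1 : nat)%:R = padic_coord n
}.

Section PadicIntRing.
Variable p : prime_nat.
Implicit Types x y z : padic_int p.

Lemma padic_modulus_gt1 n : (1 < p ^ n.+1)%N.
Proof. by rewrite -[1%N](expn0 p) ltn_exp2l // prime_gt1 // prime_natP. Qed.

Lemma padic_int_ext x y :
  (forall n, padic_coord x n = padic_coord y n) -> x = y.
Proof.
case: x y => [a ca] [b cb] /= eq_ab.
have eab : a = b by apply: functional_extensionality_dep.
by case: b / eab cb {eq_ab} => cb; congr PadicInt; apply: Prop_irrelevance.
Qed.

Lemma padic_trans_nat n k :
  (((k%:R : 'Z_(p ^ n.+2)) : nat)%:R : 'Z_(p ^ n.+1)) = k%:R.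
Proof.
rewrite val_Zp_nat ?padic_modulus_gt1 //; apply: val_inj => /=.
rewrite !val_Zp_nat ?padic_modulus_gt1 //.
by rewrite modn_dvdm // dvdn_exp2l.
Qed.

Lemma padic_trans_add n (a b : 'Z_(p ^ n.+2)) :
  ((a + b)%R : nat)%:R = (a : nat)%:R + (b : nat)%:R :> 'Z_(p ^ n.+1).
Proof. by rewrite -natrD -[RHS]padic_trans_nat natrD !natr_Zp. Qed.

Lemma padic_trans_mul n (a b : 'Z_(p ^ n.+2)) :
  ((a * b)%R : nat)%:R = (a : nat)%:R * (b : nat)%:R :> 'Z_(p ^ n.+1).
Proof. by rewrite -natrM -[RHS]padic_trans_nat natrM !natr_Zp. Qed.

Lemma padic_trans_opp n (a : 'Z_(p ^ n.+2)) :
  ((- a)%R : nat)%:R = - (a : nat)%:R :> 'Z_(p ^ n.+1).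
Proof.
by apply/eqP; rewrite -addr_eq0 -padic_trans_add addNr.
Qed.

Definition padic_int_zero : padic_int p.
Proof. by exists (fun=> 0) => n. Defined.

Definition padic_int_one : padic_int p.
Proof. by exists (fun=> 1) => n; apply: (padic_trans_nat n 1). Defined.

Definition padic_int_opp x : padic_int p.
Proof.
exists (fun n => - padic_coord x n) => n.
by rewrite padic_trans_opp padic_coherent.
Defined.

Definition padic_int_add x y : padic_int p.
Proof.
exists (fun n => padic_coord x n + padic_coord y n) => n.
by rewrite padic_trans_add !padic_coherent.
Defined.

Definition padic_int_mul x y : padic_int p.
Proof.
exists (fun n => padic_coord x n * padic_coord y n) => n.
by rewrite padic_trans_mul !padic_coherent.
Defined.

HB.instance Definition _ := gen_eqMixin (padic_int p).
HB.instance Definition _ := gen_choiceMixin (padic_int p).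

Fact padic_int_addA : associative padic_int_add.
Proof. by move=> x y z; apply: padic_int_ext => n; apply: addrA. Qed.
Fact padic_int_addC : commutative padic_int_add.
Proof. by move=> x y; apply: padic_int_ext => n; apply: addrC. Qed.
Fact padic_int_add0 : left_id padic_int_zero padic_int_add.
Proof. by move=> x; apply: padic_int_ext => n; apply: add0r. Qed.
Fact padic_int_addN : left_inverse padic_int_zero padic_int_opp padic_int_add.
Proof. by move=> x; apply: padic_int_ext => n; apply: addNr. Qed.

HB.instance Definition _ := GRing.isZmodule.Build (padic_int p)
  padic_int_addA padic_int_addC padic_int_add0 padic_int_addN.

Fact padic_int_mulA : associative padic_int_mul.
Proof. by move=> x y z; apply: padic_int_ext => n; apply: mulrA. Qed.
Fact padic_int_mulC : commutative padic_int_mul.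
Proof. by move=> x y; apply: padic_int_ext => n; apply: mulrC. Qed.
Fact padic_int_mul1 : left_id padic_int_one padic_int_mul.
Proof. by move=> x; apply: padic_int_ext => n; apply: mul1r. Qed.
Fact padic_int_mulD : left_distributive padic_int_mul padic_int_add.
Proof. by move=> x y z; apply: padic_int_ext => n; apply: mulrDl. Qed.
Fact padic_int_one_neq0 : padic_int_one != padic_int_zero.
Proof.
apply/eqP => /(congr1 (fun x => padic_coord x 0%N)) /= /eqP.
by rewrite oner_eq0.
Qed.

HB.instance Definition _ := GRing.Zmodule_isComNzRing.Build (padic_int p)
  padic_int_mulA padic_int_mulC padic_int_mul1 padic_int_mulD
  padic_int_one_neq0.

Definition padic_int_unit : {pred padic_int p} :=
  fun x => `[< exists y, y * x = 1 >].

Definition padic_int_inv x : padic_int p :=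
  if pselect (exists y, y * x = 1) is left ex then projT1 (cid ex) else x.

Fact padic_int_mulV :
  {in padic_int_unit, left_inverse 1 padic_int_inv *%R}.
Proof.
move=> x /asboolP ux; rewrite /padic_int_inv.
by case: pselect => // ex; case: (cid ex).
Qed.
Fact padic_int_unitP x y : y * x = 1 -> padic_int_unit x.
Proof. by move=> yx; apply/asboolP; exists y. Qed.
Fact padic_int_inv_out : {in [predC padic_int_unit], padic_int_inv =1 id}.
Proof.
move=> x /negP nux; rewrite /padic_int_inv; case: pselect => // ux.
by case: nux; apply/asboolP.
Qed.

HB.instance Definition _ := GRing.ComNzRing_hasMulInverse.Build (padic_int p)
  padic_int_mulV padic_int_unitP padic_int_inv_out.

Lemma padic_coord_lift x n k :
  (padic_coord x (n + k) : nat)%:R = padic_coord x n.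
Proof.
elim: k => [|k IHk]; first by rewrite addn0 natr_Zp.
rewrite addnS -IHk -(padic_coherent x (n + k)); apply: val_inj => /=.
rewrite !val_Zp_nat ?padic_modulus_gt1 //.
by rewrite modn_dvdm // dvdn_exp2l // ltnS leq_addr.
Qed.

Lemma padic_coord_eq0 x n k :
  (padic_coord x n == 0) = (p ^ n.+1 %| padic_coord x (n + k))%N.
Proof.
rewrite -(padic_coord_lift x n k) -val_eqE /= val_Zp_nat ?padic_modulus_gt1 //.
Qed.

Fact padic_int_integral : GRing.integral_domain_axiom (padic_int p).
Proof.
move=> x y xy0; apply/norP => -[xn0 yn0].
have nz (z : padic_int p) : z != 0 -> exists n, padic_coord z n != 0.
  move=> /eqP zn0; apply/not_existsP => z0; apply: zn0.
  by apply: padic_int_ext => n; apply/eqP/negPn/negP/z0.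
have [n xn] := nz x xn0; have [m ym] := nz y yn0.
have pr_p := prime_natP p; pose N := (n + m.+1)%N.
have xn' := xn; rewrite (padic_coord_eq0 x n m.+1) -/N in xn'.
have ym' := ym; rewrite (padic_coord_eq0 y m n.+1) in ym'.
have eN : (m + n.+1 = N)%N by rewrite /N !addnS addnC.
rewrite eN in ym'.
set a := nat_of_ord _ in xn'; set b := nat_of_ord _ in ym'.
have a_gt0 : (0 < a)%N by case: (a) xn' => //; rewrite dvdn0.
have b_gt0 : (0 < b)%N by case: (b) ym' => //; rewrite dvdn0.
have : (p ^ N.+1 %| a * b)%N.
  have xyN : padic_coord x N * padic_coord y N = 0.
    by have := congr1 (fun z : padic_int p => padic_coord z N) xy0.
  rewrite /dvdn -(val_Zp_nat (padic_modulus_gt1 N)) natrM.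
  by rewrite /a /b !natr_Zp xyN.
rewrite !pfactor_dvdn ?muln_gt0 ?a_gt0 // in xn' ym' *.
rewrite lognM // => le; move: xn' ym'; rewrite -!ltnNge !ltnS => la lb.
by move: (leq_trans le (leq_add la lb)); rewrite /N addnS ltnNge leqW.
Qed.

HB.instance Definition _ :=
  GRing.ComUnitRing_isIntegral.Build (padic_int p) padic_int_integral.

End PadicIntRing.

Definition padic (p : prime_nat) : fieldType := {fraction (padic_int p)}.

Definition padic_int_set (p : prime_nat) : set (padic p) :=
  range (@FracField.tofrac (padic_int p)).
Arguments padic_int_set p : clear implicits.

(* Main.v *)
From HB Require Import structures.
Require Import Defs.
From mathcomp Require Import all_field ring zify.

(* Let f be an existential formula true at a transcendental x of some field.
   Since a finitely generated domain over Z[x] specializes into any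
   algebraically closed field once a nonzero element of Z[x] is inverted, f is
   also true at X and at 1/X in the algebraic closure Om of Q(X).  The witnesses
   generate a finite extension Q(X)(theta), theta a root of a separable
   P(X, T) over Z[X].  By Newton-Puiseux, P(s^e, T) has a root expanding in
   powers of s with coefficients in a number field, and a finite truncation of
   it is a simple root modulo s after rescaling.  Infinitely many primes q have
   an embedding of that number field into Q_q (Schur), and for all but finitely
   many of them Hensel's lemma with s = q produces a root of P(q^e, T) in Q_q.
   Hence f is true at q^e and, for some other such q, at q^-e.

   If f defined Z_p for all large p, then starting from a transcendental x in
   Z_p one would get q^-e in Z_q.  If a universal formula did, its negation g
   would be true at some transcendental x outside Z_p, hence at q^e, which lies
   in Z_q. *)

Set Implicit Arguments.
Unset Strict Implicit.
Unset Printing Implicit Defensive.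

Import Order.TTheory GRing.Theory Num.Theory.
Local Open Scope ring_scope.
Local Notation tofrac := (@FracField.tofrac _).

(** * p-adic integers *)

Lemma horner_taylor2 (R : comNzRingType) (f : {poly R}) (a h : R) :
  exists g, f.[a + h] = f.[a] + f^`().[a] * h + g * h ^+ 2.
Proof.
elim/poly_ind: f => [|f c [g IH]].
  by exists 0; rewrite deriv0 !horner0 !mul0r !addr0.
exists (g * (a + h) + f^`().[a]).
by rewrite derivMXaddC !hornerMXaddC hornerD hornerMX IH; ring.
Qed.

Lemma exists_nonroot (R : idomainType) (h : nat -> R) (f : {poly R}) :
  injective h -> f != 0 -> exists n, f.[h n] != 0.
Proof.
move=> h_inj nzf.
have /allPn[x /mapP[n _ ->]] : ~~ all (root f) (mkseq h (size f)).
  apply/negP => /(max_poly_roots nzf).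
  by rewrite mkseq_uniq // size_mkseq ltnn => /(_ isT).
by move=> nr; exists n.
Qed.

Section PadicCoord.
Variable p : prime_nat.
Implicit Types (x y : padic_int p) (n : nat).

(** The level comes first so that, for fixed n, reduction modulo [p ^ n.+1] can carry a ring
    morphism structure. *)
Definition coord n x : 'Z_(p ^ n.+1) := padic_coord x n.

Arguments coord : simpl never.

Fact coord_is_zmod_morphism n : zmod_morphism (coord n).
Proof. by []. Qed.
Fact coord_is_monoid_morphism n : monoid_morphism (coord n).
Proof. by []. Qed.
HB.instance Definition _ n :=
  GRing.isZmodMorphism.Build (padic_int p) 'Z_(p ^ n.+1) (coord n)
    (coord_is_zmod_morphism n).
HB.instance Definition _ n :=
  GRing.isMonoidMorphism.Build (padic_int p) 'Z_(p ^ n.+1) (coord n)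
    (coord_is_monoid_morphism n).

Lemma coord_natr_eq0 n k : (coord n k%:R == 0) = (p ^ n.+1 %| k)%N.
Proof.
rewrite rmorph_nat -val_eqE /= val_Zp_nat ?padic_modulus_gt1 //.
Qed.

Lemma coord_intr_eq0 n (k : int) : (coord n k%:~R == 0) = (p ^ n.+1 %| `|k|)%N.
Proof.
rewrite {1}(intEsign k) rmorphM rmorph_sign rmorphM /= rmorph_sign mulrI_eq0.
  by rewrite coord_natr_eq0.
exact/lreg_sign.
Qed.

(** This is the gain of one power of p in each Newton step of [hensel]. *)
Lemma coord_mul_eq0 n x y :
  coord n x = 0 -> coord 0 y = 0 -> coord n.+1 (x * y) = 0.
Proof.
move=> /eqP; rewrite /coord (padic_coord_eq0 x n 1) addn1 => dx.
move=> /eqP; rewrite (padic_coord_eq0 y 0 n.+1) add0n => dy.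
change (coord n.+1 x * coord n.+1 y = 0).
rewrite -[coord n.+1 x]natr_Zp -[coord n.+1 y]natr_Zp -natrM.
apply: val_inj; rewrite /= val_Zp_nat ?padic_modulus_gt1 //.
by apply/eqP; have := dvdn_mul dx dy; rewrite -expnD addn1.
Qed.

Lemma coord_le n m x : (n <= m)%N -> coord m x = 0 -> coord n x = 0.
Proof.
move=> /subnKC <- x0; rewrite /coord -(padic_coord_lift x n (m - n)).
by rewrite -/(coord (n + (m - n)) x) x0.
Qed.

(** Completeness: the diagonal coordinates form a coherent sequence. *)
Lemma padic_int_limit (a : nat -> padic_int p) :
    (forall n, coord n (a n.+1) = coord n (a n)) ->
  exists b, forall n, coord n b = coord n (a n).
Proof.
move=> ca.
have coh n : (coord n.+1 (a n.+1) : nat)%:R = coord n (a n).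
  by rewrite padic_coherent; apply: ca.
by exists (PadicInt coh).
Qed.

(** Newton iteration in which w, a fixed inverse of the derivative modulo p, replaces the inverse of
    the derivative at each point. Each step gains only one power of p, which is enough. *)
Lemma hensel (f : {poly padic_int p}) a w :
  coord 0 f.[a] = 0 -> coord 0 (w * f^`().[a]) = 1 -> exists b, f.[b] = 0.
Proof.
move=> fa0; rewrite rmorphM /= => wf1;
  pose s n := iter n (fun x => x - f.[x] * w) a.
have sS n : s n.+1 = s n - f.[s n] * w by [].
have s0 n : coord 0 (s n) = coord 0 a /\ coord n f.[s n] = 0.
  elim: n => [//|n [IH0 IHn]]; have f0 := coord_le (leq0n n) IHn.
  split; first by rewrite sS rmorphB rmorphM /= f0 mul0r subr0.
  have [g] := horner_taylor2 f (s n) (- (f.[s n] * w)).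
  rewrite -sS => ->.
  (* The new value is the old one times a factor that vanishes modulo p. *)
  have -> : f.[s n] + f^`().[s n] * - (f.[s n] * w)
      + g * (- (f.[s n] * w)) ^+ 2
    = f.[s n] * (1 - w * f^`().[s n] + g * w ^+ 2 * f.[s n]) by ring.
  apply: coord_mul_eq0 => //.
  rewrite rmorphD [X in _ + X]rmorphM /= f0 mulr0 addr0.
  rewrite rmorphB rmorph1 rmorphM /= -[coord 0 _.[_]]horner_map /= IH0.
  by rewrite horner_map /= wf1 subrr.
have [b Db] : exists b, forall n, coord n b = coord n (s n).
  apply: padic_int_limit => n; have [_ fn0] := s0 n.
  by rewrite sS rmorphB rmorphM /= fn0 mul0r subr0.
exists b; apply: padic_int_ext => n; rewrite -/(coord n f.[b]).
rewrite -horner_map /= Db horner_map /=.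
by have [_ ->] := s0 n.
Qed.

Lemma coord0_inv x : coord 0 x != 0 -> exists w, coord 0 (w * x) = 1.
Proof.
move=> x0; pose u := coord 0 x.
have Uu : u \is a GRing.unit.
  rewrite -[u]natr_Zp unitZpE ?padic_modulus_gt1 // coprime_pexpl //.
  rewrite prime_coprime ?prime_natP //; apply: contra x0 => pu.
  have dvd1 k : (p %| k)%N -> (p ^ 1 %| k)%N by rewrite expn1.
  by move/dvd1: pu; rewrite -coord_natr_eq0 rmorph_nat natr_Zp.
exists (nat_of_ord (u^-1))%:R.
by rewrite rmorphM rmorph_nat natr_Zp mulVr.
Qed.

(** Hensel's lemma produces the inverse as the root of x X - 1. *)
Lemma padic_int_unitE x : (x \is a GRing.unit) = (coord 0 x != 0).
Proof.
apply/idP/idP => [/(rmorph_unit (coord 0))/=|/coord0_inv[w wx]].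
  by apply: contraTneq => ->; rewrite unitr0.
have [||b] := @hensel (x *: 'X - 1) w w.
- by rewrite !hornerE rmorphB /= [x * w]mulrC wx rmorph1 subrr.
- by rewrite !derivE !hornerE subr0.
rewrite !hornerE => /eqP; rewrite subr_eq0 => /eqP xb.
by apply/unitrP; exists b; rewrite mulrC xb.
Qed.

End PadicCoord.

Arguments coord : simpl never.

(** * A transcendental p-adic integer *)

Section Liouville.
Variable p : prime_nat.

(* The exponents grow so fast that [f.[liou n]], which is divisible by
   [p ^ (n * liou n)] when f vanishes at the limit, must be 0 for large n. *)
Fixpoint liou n : nat := if n is m.+1 then liou m + p ^ (m.+1 * liou m) else p.

Lemma liou_ltn : {homo liou : m n / (m < n)%N}.
Proof.
apply: homo_ltn; first exact: ltn_trans.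
by move=> n /=; rewrite -[ltnLHS]addn0 ltn_add2l expn_gt0 prime_gt0 ?prime_natP.
Qed.

Lemma liou_gt1 n : (1 < liou n)%N.
Proof.
have p1 : (1 < p)%N by rewrite prime_gt1 ?prime_natP.
by case: n => // n; apply: (ltn_trans p1); apply: (liou_ltn (ltn0Sn n)).
Qed.

(** The increments from index n on are powers of p with exponents at least [n * liou n]. *)
Lemma liou_cong n m : (n <= m)%N -> liou m = liou n %[mod p ^ (n * liou n)].
Proof.
move=> /subnKC <-; elim: (m - n)%N => [|k IH]; first by rewrite addn0.
rewrite addnS /= -modnDm IH.
have /eqP-> : (p ^ (n * liou n) %| p ^ ((n + k).+1 * liou (n + k)))%N.
  rewrite dvdn_exp2l // leq_mul ?leqW ?leq_addr //.
  by case: k {IH} => [|k];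
    rewrite ?addn0 // ltnW // liou_ltn // addnS ltnS leq_addr.
by rewrite addn0 modn_mod.
Qed.

(** With y = [liou n]: H y^d <= y^(H+d) <= y^n < (2^y)^n <= p^(n y). *)
Lemma ltn_exp_liou n (H d : nat) : (0 < H)%N -> (H + d <= n)%N ->
  (H * liou n ^ d < p ^ (n * liou n))%N.
Proof.
move=> H_gt0 le_n; move: (liou n) (liou_gt1 n) => y y1.
apply: (@leq_trans (2 ^ (n * y))); last first.
  by rewrite leq_exp2r ?muln_gt0 ?prime_gt1 ?prime_natP //; lia.
rewrite [(n * y)%N]mulnC expnM; apply: (@leq_ltn_trans (y ^ n)); last first.
  by rewrite ltn_exp2r; [apply: ltn_expl | lia].
apply: (@leq_trans (y ^ (H + d))); last by rewrite leq_exp2l.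
by rewrite expnD leq_mul // ltnW // ltn_expl.
Qed.

Lemma liou_cong_le n m N : (n <= m)%N -> (N <= n * liou n)%N ->
  liou m = liou n %[mod p ^ N].
Proof.
move=> /liou_cong/(congr1 (modn^~ (p ^ N)%N)) + leN.
have dv : (p ^ N %| p ^ (n * liou n))%N by rewrite dvdn_exp2l.
by rewrite /= !(modn_dvdm _ dv).
Qed.

Lemma leq_mul_liou n : (n <= n * liou n)%N.
Proof. by rewrite leq_pmulr // ltnW // liou_gt1. Qed.

Fact liouville_coherent n :
  (((liou n.+2)%:R : 'Z_(p ^ n.+2)) : nat)%:R
    = (liou n.+1)%:R :> 'Z_(p ^ n.+1).
Proof.
rewrite padic_trans_nat; apply: val_inj.
rewrite /= !val_Zp_nat ?padic_modulus_gt1 //.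
exact: liou_cong_le (leqnSn n.+1) (leq_mul_liou n.+1).
Qed.

Definition liouville : padic_int p := PadicInt liouville_coherent.

(** Divisibility by p puts the inverse of this number outside Z_p. *)
Lemma coord0_liouville : coord 0 liouville = 0.
Proof.
rewrite /coord /=; apply: val_inj; rewrite /= val_Zp_nat ?padic_modulus_gt1 //.
apply/eqP; rewrite -[_ == _]/(p ^ 1 %| p + p ^ (1 * p))%N expn1 mul1n.
by rewrite dvdn_add // dvdn_exp // prime_gt0 ?prime_natP.
Qed.

Lemma horner_int_bound (f : {poly int}) (y : nat) : (0 < y)%N ->
  (`|(f.[y%:R])%R| <= (\sum_(i < size f) `|(f`_i)%R|) * y ^ size f)%N.
Proof.
move=> y0; rewrite horner_coef big_distrl /=.
elim/big_ind2: _ => [//|m1 n1 m2 n2 le1 le2|i _].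
  by apply: leq_trans (leq_add le1 le2); lia.
by rewrite abszM leq_mul // -natrX natz absz_nat leq_pexp2l // ltnW.
Qed.

Lemma coord_liouville n N : (N < n * liou n)%N ->
  coord N liouville = (liou n)%:R.
Proof.
move=> ltN; rewrite /coord /=; apply: val_inj.
rewrite /= !val_Zp_nat ?padic_modulus_gt1 //.
have [le_n|lt_n] := leqP n N.+1; first exact: (liou_cong_le le_n).
exact/esym/(liou_cong_le (ltnW lt_n))/leq_mul_liou.
Qed.

Lemma liouville_transcendental (f : {poly int}) :
  (map_poly intr f).[liouville] = 0 -> f = 0.
Proof.
move=> fx0; apply/eqP; apply: contraT => nzf.
pose H := (\sum_(i < size f) `|(f`_i)%R|)%N.
have H_gt0 : (0 < H)%N.
  have lt_sz : ((size f).-1 < size f)%N by rewrite prednK // size_poly_gt0.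
  rewrite /H (bigD1 (Ordinal lt_sz)) //= addn_gt0 absz_gt0 -lead_coefE.
  by rewrite lead_coef_eq0 nzf.
(* The index is pushed past [H + size f] so that [ltn_exp_liou] applies; since [liou] is injective,
   f is nonzero at some such value. *)
have [n] : exists n, f.[(liou (H + size f + n))%:R] != 0.
  apply: exists_nonroot nzf => m n /eqP.
  rewrite !natz eqz_nat => /eqP eq_l; apply/eqP;
    rewrite -(eqn_add2l (H + size f)).
  by case: ltngtP => // /liou_ltn; rewrite eq_l ltnn.
set k := (H + size f + n)%N => nz.
have k_gt0 : (0 < k * liou k)%N.
  by rewrite muln_gt0 (ltnW (liou_gt1 _)) andbT /k; lia.
(* Modulo [p ^ (k * liou k)] the integer [f.[liou k]] agrees with the value of f at the limit, which
   is 0. *)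
have : coord (k * liou k).-1 (f.[(liou k)%:R]%:~R : padic_int p) == 0.
  have -> : f.[(liou k)%:R]%:~R = (map_poly intr f).[(liou k)%:R] :> padic_int
    p.
    by rewrite -horner_map /= rmorph_nat.
  rewrite -horner_map /= rmorph_nat.
  rewrite -(coord_liouville (n := k)) ?prednK // horner_map.
  by rewrite fx0 rmorph0.
rewrite coord_intr_eq0 prednK // => /dvdn_leq; rewrite absz_gt0 => /(_ nz).
rewrite leqNgt => /negP; case.
apply: leq_ltn_trans (horner_int_bound f (ltnW (liou_gt1 k))) _.
by apply: ltn_exp_liou; rewrite // leq_addr.
Qed.

End Liouville.

(** Write f = g X + c with c = f(0), and let M = N!. Then f(c M t) = c (1 + M t g(c M t)), and a
    prime dividing the second factor cannot divide N!, hence exceeds N. *)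
Lemma schur_prime_divisor (f : {poly int}) N : (1 < size f)%N ->
  exists q : prime_nat, exists a : int, (N < q)%N /\ (q %| `|f.[a]|)%N.
Proof.
move=> f_gt1.
have natint_inj : injective (fun n : nat => n%:R : int) by move=> m n /eqP;
  rewrite !natz => /eqP[].
have [z0|nzf0] := eqVneq f.[0] 0.
  have [q ltNq prq] := prime_above N.
  by exists (PrimeNat prq), 0; rewrite z0 dvdn0.
pose c := f.[0]; pose M : int := N`!.
have /factor_theorem[g Dg] : root (f - c%:P) 0 by rewrite /root !hornerE subrr.
rewrite subr0 in Dg.
have nzM : M != 0 by rewrite /M; have := fact_gt0 N; lia.
have nzg : g != 0.
  apply: contraTneq f_gt1 => g0; move/eqP: Dg;
    rewrite g0 mul0r subr_eq0 => /eqP ->.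
  by rewrite -leqNgt size_polyC leq_b1.
have [F szF FE] : exists2 F : {poly int}, (1 < size F)%N
    & forall t, F.[t] = 1 + M * (t * g.[c * M * t]).
  exists (1 + M *: ('X * (g \Po ((c * M) *: 'X)))) => [|t]; last first.
    by rewrite !(hornerE, horner_comp).
  have szX : size ((c * M) *: 'X : {poly int}) = 2%N.
    by rewrite size_scale ?size_polyX // mulf_neq0.
  have nzgc : g \Po ((c * M) *: 'X) != 0 by rewrite comp_poly2_eq0 // szX.
  have sz : (1 < size (M *: ('X * (g \Po ((c * M) *: 'X)))))%N.
    by rewrite size_scale // mulrC size_mulX // ltnS lt0n size_poly_eq0.
  by rewrite addrC size_polyDl // size_poly1.
have nzF (b : int) : F + b%:P != 0.
  rewrite -size_poly_gt0 size_polyDl ?(ltnW szF) //.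
  by apply: leq_ltn_trans szF; rewrite size_polyC leq_b1.
(* The value F(t) must avoid 0, 1 and -1 in order to have a prime divisor. *)
have [t] : exists n : nat, ((F + 0%:P) * (F + 1%:P) * (F + (-1)%:P)).[n%:R] !=
  0.
  by apply: exists_nonroot natint_inj _; rewrite !mulf_neq0.
rewrite !(hornerM, hornerD, hornerC); set x := F.[_] => nzx.
have Dx : f.[c * M * t%:R] = c * x.
  move/(canRL (subrK _)): Dg => ->;
    rewrite /x FE !(hornerD, hornerM, hornerC, hornerX).
  by rewrite -/c; ring.
have x_gt1 : (1 < `|x|)%N by move: nzx; rewrite !mulf_eq0; lia.
have prq := pdiv_prime x_gt1; exists (PrimeNat prq), (c * M * t%:R) => /=.
split; last by rewrite Dx abszM dvdn_mull // pdiv_dvd.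
rewrite ltnNge; apply: contraTN (prime_gt1 prq) => le_q; rewrite -leqNgt.
have qx : (pdiv `|x| %| x)%Z by rewrite dvdzE /= pdiv_dvd.
have qM : (pdiv `|x| %| M)%Z by rewrite dvdzE /= dvdn_fact // pdiv_gt0.
have : (pdiv `|x| %| (1 : int)%R)%Z.
  have -> : (1 : int) = x - M * (t%:R * g.[c * M * t%:R]).
    by rewrite /x FE; ring.
  by rewrite rpredB // dvdz_mulr.
by rewrite dvdzE /= dvdn1 => /eqP->.
Qed.

(** For q > |D| the Bezout identity makes v(a) f'(a) a unit modulo q at a root a of f modulo q, so
    Hensel's lemma lifts a. *)
Lemma int_poly_padic_root (f u v : {poly int}) (D : int) N :
    (1 < size f)%N -> u * f + v * f^`() = D%:P -> D != 0 ->
  exists q : prime_nat, (N < q)%N /\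
    exists b : padic_int q, (map_poly intr f).[b] = 0.
Proof.
move=> f_gt1 bez nzD.
have [q [a [ltq qa]]] := schur_prime_divisor (N + `|D|) f_gt1.
exists q; split; first by apply: leq_ltn_trans ltq; rewrite leq_addr.
have D0 : coord 0 (D%:~R : padic_int q) != 0.
  rewrite coord_intr_eq0 expn1; apply/negP => /dvdn_leq;
    rewrite absz_gt0 => /(_ nzD).
  by apply/negP; rewrite -ltnNge; apply: leq_ltn_trans ltq; rewrite leq_addl.
have fa0 : coord 0 (f.[a]%:~R : padic_int q) = 0.
  by apply/eqP; rewrite coord_intr_eq0 expn1.
have DE : D%:~R = u.[a]%:~R * f.[a]%:~R + v.[a]%:~R * f^`().[a]%:~R :>
  padic_int q.
  by rewrite -!rmorphM -rmorphD -!hornerM -hornerD bez hornerC.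
have [w wD] := coord0_inv D0.
apply: (@hensel _ _ a%:~R (w * v.[a]%:~R)); first by rewrite horner_map.
rewrite deriv_map horner_map -wD DE mulrDr !mulrA [in RHS]rmorphD /=.
by rewrite [X in X + _]rmorphM /= fa0 mulr0 add0r.
Qed.

(** * Specialization of existential formulas *)

Section ClosedFieldRoots.
Variable (F : closedFieldType).

(** If g vanished at every root of f, then f, a constant times at most [size f] linear factors,
    would divide [g ^+ size f]. *)
Lemma root_avoiding (f g : {poly F}) :
  f != 0 -> ~~ (f %| g ^+ size f) -> exists2 z, root f z & g.[z] != 0.
Proof.
move=> nzf; apply: contraNP => all_g.
have [r Df] := closed_field_poly_normal f.
have szr : (size r <= size f)%N.
  by rewrite Df size_scale ?lead_coef_eq0 // size_prod_XsubC.
have gr z : z \in r -> root g z.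
  move=> rz; apply: contra_notT all_g => gz; exists z => //.
  by rewrite Df rootZ ?lead_coef_eq0 // root_prod_XsubC.
apply: dvdp_trans (dvdp_exp2l _ szr); rewrite Df dvdpZl ?lead_coef_eq0 //.
elim: r gr {Df szr} => [|z r IHr] gr; first by rewrite big_nil dvd1p.
rewrite big_cons exprS dvdp_mul //.
  by rewrite dvdp_XsubCl gr // mem_head.
by apply: IHr => x rx; rewrite gr // inE rx orbT.
Qed.

End ClosedFieldRoots.

Section Specialization.
Variables (A : idomainType) (K : fieldType) (Om : closedFieldType).
Hypothesis natOm_inj : injective (fun n : nat => n%:R : Om).
Variable phi : {rmorphism A -> K}.

Lemma map_poly_ker (psi : {rmorphism A -> Om}) (f : {poly A}) :
    (forall x, phi x = 0 -> psi x = 0) ->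
  map_poly phi f = 0 -> map_poly psi f = 0.
Proof.
move=> ker f0; apply/polyP => i; rewrite coef_map coef0 /=; apply: ker.
by rewrite -coef_map f0 coef0.
Qed.

(* Let P be a relation of least degree for y.  A root z of the specialized P
   with b(z) != 0 exists as soon as the remainder of b ^ (deg P + 1) by P stays
   nonzero; that remainder and the leading coefficient of P give a. *)
Lemma specialize_step (y : K) (b : {poly A}) : (map_poly phi b).[y] != 0 ->
  exists2 a, phi a != 0 & forall psi : {rmorphism A -> Om},
    (forall x, phi x = 0 -> psi x = 0) -> psi a != 0 ->
    exists2 z, (forall f, (map_poly phi f).[y] = 0 -> (map_poly psi f).[z] = 0)
      & (map_poly psi b).[z] != 0.
Proof.
move=> nzb; pose van f := (map_poly phi f).[y] = 0 /\ map_poly phi f != 0.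
have nz_coef (B : fieldType) (h : {rmorphism A -> B}) (f : {poly A}) :
    map_poly h f != 0 -> exists i, h f`_i != 0.
  move=> nz; exists (size (map_poly h f)).-1.
  by rewrite -coef_map -lead_coefE lead_coef_eq0.
have coef_nz (B : fieldType) (h : {rmorphism A -> B}) (f : {poly A}) i :
    h f`_i != 0 -> map_poly h f != 0.
  by apply: contraNneq => h0; rewrite -coef_map h0 coef0.
(* When y satisfies no nontrivial relation, any z avoiding the roots of the specialized b will do;
   it is found among the natural numbers. *)
have [[f0 vf0]|nvan] := pselect (exists f, van f); last first.
  have nzb' : map_poly phi b != 0 by apply: contraNneq nzb => ->;
    rewrite horner0.
  have [i nzi] := nz_coef _ phi b nzb'; exists b`_i => // psi ker nza.
  have [n nzn] := exists_nonroot natOm_inj (coef_nz _ psi b i nza).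
  exists n%:R => // f fy; rewrite (map_poly_ker ker) ?horner0 //.
  by apply/eqP; apply: contra_notT nvan => nzf; exists f.
pose Q k := `[< exists2 f, van f & size f = k >].
have exQ : exists k, Q k by exists (size f0); apply/asboolP; exists f0.
case: (ex_minnP exQ) => _ /asboolP[P [Py nzP] <-] minP.
have small (f : {poly A}) : (size f < size P)%N ->
  (map_poly phi f).[y] = 0 -> map_poly phi f = 0.
  move=> ltf fy; apply/eqP; apply: contraTT ltf => nzf; rewrite -leqNgt.
  by apply: minP; apply/asboolP; exists f.
have P0 : P != 0 by apply: contraNneq nzP => ->; rewrite rmorph0.
(* Otherwise dropping the leading term of P would give a shorter relation. *)
have nzl : phi (lead_coef P) != 0.
  apply/eqP => l0; have eqP1 : map_poly phi (\poly_(i < (size P).-1) P`_i) =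
    map_poly phi P.
    apply/polyP => i; rewrite !coef_map coef_poly /=; case: ltnP => // le.
    have [->|ne] := eqVneq i (size P).-1;
      first by rewrite -lead_coefE l0 rmorph0.
    by rewrite [P`_i]nth_default //; move: le ne;
      rewrite leq_eqVlt eq_sym => /orP[->//|]; case: (size P).
  move/eqP: nzP; apply; rewrite -eqP1; apply: small; last by rewrite eqP1.
  by apply: leq_ltn_trans (size_poly _ _) _; rewrite prednK // size_poly_gt0.
have phi_div f := congr1 (map_poly phi) (Pdiv.Idomain.divp_eq f P).
pose r := b ^+ size P %% P.
have nzr : map_poly phi r != 0.
  apply/eqP => r0; have := phi_div (b ^+ size P).
  rewrite -/r rmorphD rmorphM /= r0 addr0 -mul_polyC rmorphM /= map_polyC /= =>
    /(congr1 (horner^~ y)).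
  rewrite !hornerM Py mulr0 hornerC !rmorphXn /= horner_exp => /eqP.
  by rewrite mulf_eq0 !expf_eq0 (negPf nzb) (negPf nzl) !andbF.
have [i nzri] := nz_coef _ phi r nzr.
exists (lead_coef P * r`_i); first by rewrite rmorphM mulf_neq0.
move=> psi ker; rewrite rmorphM mulf_eq0 negb_or => /andP[psil psir].
have psi_div f := congr1 (map_poly psi) (Pdiv.Idomain.divp_eq f P).
have szP : size (map_poly psi P) = size P by rewrite size_poly_eq.
have psiP0 : map_poly psi P != 0 by rewrite -size_poly_gt0 szP size_poly_gt0.
have [|z Pz bz] := root_avoiding (g := map_poly psi b) psiP0.
  rewrite szP; apply/negP => dv.
  have : map_poly psi P %| map_poly psi r.
    have := psi_div (b ^+ size P); rewrite -/r rmorphD rmorphM /= => Dr.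
    rewrite -(dvdp_addr _ (dvdp_mulIr (map_poly psi (b ^+ size P %/ P)) _)) -Dr.
    by rewrite -mul_polyC rmorphM dvdp_mull // rmorphXn.
  move/dvdp_leq => /(_ (coef_nz _ psi r i psir)); rewrite szP leqNgt => /negP;
    apply.
  apply: leq_ltn_trans (size_poly _ _) _.
  by rewrite Pdiv.Idomain.ltn_modp.
exists z => // f fy.
(* The remainder of f by P vanishes at y and is shorter than P, so its image under phi is 0 by
   minimality, and hence so is its image under psi. *)
have m0 : map_poly psi (f %% P) = 0.
  apply: (map_poly_ker ker); apply: small;
    first by rewrite Pdiv.Idomain.ltn_modp.
  have := phi_div f; rewrite rmorphD rmorphM /= -mul_polyC rmorphM =>
    /(congr1 (horner^~ y)) /=.
  by rewrite hornerD !hornerM Py fy !mulr0 add0r.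
have := psi_div f; rewrite rmorphD rmorphM /= m0 addr0 -mul_polyC rmorphM /=
  map_polyC.
move=> /(congr1 (horner^~ z));
  rewrite !hornerM (rootP Pz) mulr0 hornerC => /eqP.
by rewrite mulf_eq0 /= rmorphXn expf_eq0 (negPf psil) andbF => /eqP.
Qed.

End Specialization.

(** The outermost indeterminate is the de Bruijn variable 0, the one bound by a quantifier, so that
    [specialize_step] handles one quantifier at a time. *)
Fixpoint multipoly n : idomainType :=
  if n is m.+1 then {poly (multipoly m)} else int.

Fixpoint mpeval (K : comNzRingType) n (u : seq K) : {rmorphism multipoly n ->
  K} :=
  match n return {rmorphism multipoly n -> K} with
  | 0 => intr
  | m.+1 => horner_eval (head 0 u) \o map_poly (mpeval m (behead u))
  end.

Fixpoint mpvar n (i : nat) : multipoly n :=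
  match n return multipoly n with
  | 0 => 0
  | m.+1 => if i is j.+1 then (mpvar m j)%:P else 'X
  end.

Lemma mpeval_var (K : comNzRingType) n (u : seq K) i :
  (i < n)%N -> mpeval n u (mpvar n i) = nth 0 u i.
Proof.
elim: n u i => [//|n IHn] u [|i] lt_in /=.
  by rewrite /horner_eval map_polyX hornerX nth0.
by rewrite /horner_eval map_polyC hornerC /= IHn // nth_behead.
Qed.

Fixpoint term_poly n (t : term n) : multipoly n :=
  match t with
  | TVar i => mpvar n i
  | TZero => 0
  | TOne => 1
  | TOpp u => - term_poly u
  | TAdd u v => term_poly u + term_poly v
  | TMul u v => term_poly u * term_poly v
  end.

Lemma mpeval_term (K : comNzRingType) n (u : n.-tuple K) t :
  mpeval n u (term_poly t) = teval u t.
Proof.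
elim: t => [i|||s IHs|s IHs t IHt|s IHs t IHt] /=.
- by rewrite mpeval_var // -tnth_nth.
- exact: rmorph0.
- exact: rmorph1.
- by rewrite rmorphN IHs.
- by rewrite rmorphD IHs IHt.
- by rewrite rmorphM IHs IHt.
Qed.

Section Transfer.
Variables (K : fieldType) (Om : closedFieldType).
Hypothesis natOm_inj : injective (fun n : nat => n%:R : Om).

(** Equivalently, u -> v extends to a ring homomorphism from Z[u] to Z[v]. *)
Definition specializes n (u : n.-tuple K) (v : n.-tuple Om) :=
  forall f, mpeval n u f = 0 -> mpeval n v f = 0.

(** True equations stay true under specialization; b is a product of the differences of the two
    sides of the false ones, which must stay nonzero. *)
Lemma qf_specialize n (f : formula n) (u : n.-tuple K) : quantifier_free f ->
  exists2 b, mpeval n u b != 0 & forall v, specializes u v ->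
    mpeval n v b != 0 -> (holds f u <-> holds f v).
Proof.
elim: f u => {n} n => [s t|f IHf|f IHf g IHg|f IHf g IHg|//|//] u /=.
- move=> _; pose d := term_poly s - term_poly t.
  have du : mpeval n u d = teval u s - teval u t by rewrite rmorphB
    !mpeval_term.
  have dv (v : n.-tuple Om) : mpeval n v d = teval v s - teval v t.
    by rewrite rmorphB !mpeval_term.
  have [d0|dn0] := eqVneq (mpeval n u d) 0.
    exists 1 => [|v uv _]; first by rewrite rmorph1 oner_eq0.
    split=> _; apply/eqP; rewrite -subr_eq0; first by rewrite -dv (uv _ d0).
    by rewrite -du d0.
  exists d => // v uv vn0; split=> e; first by rewrite du e subrr eqxx in dn0.
  by rewrite dv e subrr eqxx in vn0.
- by move=> /(IHf u)[b nzb Hb]; exists b => // v uv /(Hb v uv) ->.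
- move=> /andP[/(IHf u)[b nzb Hb] /(IHg u)[c nzc Hc]].
  exists (b * c); rewrite ?rmorphM ?mulf_neq0 // => v uv.
  rewrite rmorphM mulf_eq0 negb_or => /andP[/(Hb v uv) hb /(Hc v uv) hc].
  by rewrite hb hc.
- move=> /andP[/(IHf u)[b nzb Hb] /(IHg u)[c nzc Hc]].
  exists (b * c); rewrite ?rmorphM ?mulf_neq0 // => v uv.
  rewrite rmorphM mulf_eq0 negb_or => /andP[/(Hb v uv) hb /(Hc v uv) hc].
  by rewrite hb hc.
Qed.

(** Each witness is removed by [specialize_step], which turns a nonvanishing condition involving the
    witness into one on the remaining variables. *)
Lemma existential_specialize n (f : formula n) (u : n.-tuple K) :
    existential f -> holds f u ->
  exists2 a, mpeval n u a != 0 & forall v, specializes u v ->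
    mpeval n v a != 0 -> holds f v.
Proof.
have qf n' (g : formula n') (w : n'.-tuple K) : quantifier_free g ->
  holds g w ->
    exists2 a, mpeval n' w a != 0 & forall v, specializes w v ->
    mpeval n' v a != 0 -> holds g v.
  by move=> /(qf_specialize w)[b nzb Hb] gw;
    exists b => // v uv /(Hb v uv) [+ _]; apply.
elim: f u => {n} n => [s t|f _|f _ g _|f _ g _|f IHf|//] u; try exact: qf.
move=> /= ex_f [y /(IHf _ ex_f)[b nzb Hb]].
have [a nza Ha] := specialize_step natOm_inj nzb.
exists a => // v uv nzv; have [z zv bz] := Ha (mpeval n v) uv nzv.
by exists z; apply: Hb.
Qed.

End Transfer.

(** * Partial homomorphisms and existential formulas *)

Section PartialHom.
Variables (Om L : fieldType).

(* The values of [s] outside [S] are irrelevant. *)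
Definition partial_hom (S : Om -> Prop) (s : Om -> L) :=
  [/\ S 1, s 1 = 1,
      forall x y, S x -> S y -> S (x - y) /\ s (x - y) = s x - s y &
      forall x y, S x -> S y -> S (x * y) /\ s (x * y) = s x * s y].

Variables (S : Om -> Prop) (s : Om -> L).
Hypothesis homS : partial_hom S s.

Lemma phom0 : S 0 /\ s 0 = 0.
Proof.
have [S1 _ B _] := homS; have [] := B _ _ S1 S1.
by rewrite !subrr.
Qed.

Lemma phomN x : S x -> S (- x) /\ s (- x) = - s x.
Proof.
have [S0 s0] := phom0; have [_ _ B _] := homS => Sx.
by have [] := B _ _ S0 Sx; rewrite !sub0r s0 sub0r.
Qed.

Lemma phomD x y : S x -> S y -> S (x + y) /\ s (x + y) = s x + s y.
Proof.
have [_ _ B _] := homS => Sx /phomN[Sy sy].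
by have [] := B _ _ Sx Sy; rewrite sy !opprK.
Qed.

Lemma phomM x y : S x -> S y -> S (x * y) /\ s (x * y) = s x * s y.
Proof. by have [_ _ _] := homS; apply. Qed.

Lemma phom_eq x y : S x -> S y -> (x - y != 0 -> s (x - y) != 0) ->
  x = y <-> s x = s y.
Proof.
have [_ _ B _] := homS => Sx Sy nz; split=> [->//|e]; apply/eqP.
rewrite -subr_eq0; apply: contraT => /nz; have [_ ->] := B _ _ Sx Sy.
by rewrite e subrr eqxx.
Qed.

Lemma phom_teval n (u : n.-tuple Om) (t : term n) :
    (forall i, S (tnth u i)) ->
  S (teval u t) /\ s (teval u t) = teval (map_tuple s u) t.
Proof.
have [S0 s0] := phom0; have [S1 s1 _ _] := homS.
move=> Su; elim: t => [i|||a [Sa sa]|a [Sa sa] b [Sb sb]|a [Sa sa] b [Sb sb]]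
  //=.
- by rewrite tnth_map.
- by have [] := phomN Sa; rewrite sa.
- by have [] := phomD Sa Sb; rewrite sa sb.
- by have [] := phomM Sa Sb; rewrite sa sb.
Qed.

Definition phom_good (l : seq Om) :=
  forall x, x \in l -> S x /\ (x != 0 -> s x != 0).

Lemma phom_good_cat l1 l2 : phom_good (l1 ++ l2) ->
  phom_good l1 /\ phom_good l2.
Proof.
by move=> gl; split=> x xl; apply: gl; rewrite mem_cat xl ?orbT.
Qed.

End PartialHom.

(** The list consists of the differences of the two sides of the equations in f. It is fixed before
    the homomorphism, which can then be chosen to suit it. *)
Lemma qf_phom (Om : fieldType) n (f : formula n) (u : n.-tuple Om) :
    quantifier_free f ->
  exists l : seq Om, forall (L : fieldType) (S : Om -> Prop) (s : Om -> L),
    partial_hom S s -> (forall i, S (tnth u i)) -> phom_good S s l ->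
    (holds f u <-> holds f (map_tuple s u)).
Proof.
elim: f u => {n} n => [t1 t2|f IHf|f IHf g IHg|f IHf g IHg|//|//] u /=.
- move=> _; exists [:: teval u t1 - teval u t2] => L S s homS Su gl.
  have [S1 s1] := phom_teval homS t1 Su; have [S2 s2] := phom_teval homS t2 Su.
  rewrite -s1 -s2; apply: (phom_eq homS) => //.
  by have [] := gl _ (mem_head _ _).
- by move=> /(IHf u)[l Hl]; exists l => L S s homS Su /(Hl _ _ _ homS Su) ->.
- move=> /andP[/(IHf u)[l Hl] /(IHg u)[m Hm]]; exists (l ++ m) => L S s homS Su.
  by move=> /phom_good_cat[/(Hl _ _ _ homS Su) -> /(Hm _ _ _ homS Su) ->].
- move=> /andP[/(IHf u)[l Hl] /(IHg u)[m Hm]]; exists (l ++ m) => L S s homS Su.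
  by move=> /phom_good_cat[/(Hl _ _ _ homS Su) -> /(Hm _ _ _ homS Su) ->].
Qed.

(** The witnesses join the list, so that they lie in the domain S and their images are witnesses
    again. *)
Lemma existential_phom (Om : fieldType) n (f : formula n) (u : n.-tuple Om) :
    existential f -> holds f u ->
  exists l : seq Om, forall (L : fieldType) (S : Om -> Prop) (s : Om -> L),
    partial_hom S s -> (forall i, S (tnth u i)) -> phom_good S s l ->
    holds f (map_tuple s u).
Proof.
have qf n' (g : formula n') (w : n'.-tuple Om) : quantifier_free g ->
  holds g w ->
  exists l : seq Om, forall (L : fieldType) (S : Om -> Prop) (s : Om -> L),
    partial_hom S s -> (forall i, S (tnth w i)) -> phom_good S s l ->
    holds g (map_tuple s w).
  move=> /(qf_phom w)[l Hl] gw; exists l => L S s homS Sw gl.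
  by apply/(Hl L S s homS Sw gl).
elim: f u => {n} n => [t1 t2|f _|f _ g _|f _ g _|f IHf|//] u; try exact: qf.
move=> /= ex_f [y /(IHf _ ex_f)[l Hl]]; exists (y :: l) => L S s homS Su gl.
have [Sy _] := gl y (mem_head _ _).
exists (s y); have -> : [tuple of s y :: map_tuple s u] = map_tuple s [tuple of
  y :: u].
  exact: val_inj.
apply: Hl homS _ _.
  by move=> i; case: (unliftP ord0 i) => [j ->|->]; rewrite ?tnthS // tnth0.
by move=> x xl; apply: gl; rewrite inE xl orbT.
Qed.

Lemma universal_negation n (f : formula n) : universal f ->
  exists2 g : formula n, existential g &
    forall (K : nzRingType) (e : n.-tuple K), holds g e <-> ~ holds f e.
Proof.
have qf n' (g : formula n') : quantifier_free g ->
   exists2 h : formula n', existential h &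
    forall (K : nzRingType) (e : n'.-tuple K), holds h e <-> ~ holds g e.
  by move=> qg; exists (FNot g).
elim: f => {n} n => [t1 t2|f _|f _ g _|f _ g _|//|f IHf]; try exact: qf.
move=> /IHf[g exg Hg]; exists (FEx g) => // K e; split=> /=.
  by move=> [x /Hg nf] /(_ x).
by move=> /existsNP[x nf]; exists x; apply/Hg.
Qed.

(** * Partial homomorphisms from a primitive element *)

Section PrimitiveElement.
(** E is the fraction field of R and Om is algebraic over it. The two instances are Z, Q, [algC] and
    Z[X], Q(X), an algebraic closure of Q(X). *)
Variables (R : idomainType) (E Om : fieldType).
Variables (j : {rmorphism R -> E}) (i : {rmorphism E -> Om}).
Hypothesis j_inj : injective j.
Hypothesis fracE : forall x : E, exists a b, b != 0 /\ j b * x = j a.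
Hypothesis charE : [pchar E] =i pred0.
Hypothesis algOm : forall w : Om, algebraicOver i w.

Let io : {rmorphism R -> Om} := i \o j.

Lemma io_inj : injective io.
Proof. by move=> x y /fmorph_inj/j_inj. Qed.

Lemma io_eq0 x : (io x == 0) = (x == 0).
Proof. by rewrite -(rmorph0 io) (inj_eq io_inj). Qed.

Lemma common_denominator (l : seq E) :
  exists2 d, d != 0 & forall x, x \in l -> exists a, j d * x = j a.
Proof.
elim: l => [|x l [d nzd IHl]]; first by exists 1; rewrite ?oner_eq0.
have [a [b [nzb Db]]] := fracE x; exists (b * d); first by rewrite mulf_neq0.
move=> y; rewrite inE => /predU1P[->|/IHl[c Dc]].
  by exists (d * a); rewrite mulrC rmorphM mulrA [x * _]mulrC Db mulrC rmorphM.
by exists (b * c); rewrite !rmorphM -mulrA Dc.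
Qed.

Lemma clear_denominators (f : {poly E}) :
  exists d F, d != 0 /\ map_poly j F = j d *: f.
Proof.
have [d nzd Hd] := common_denominator f.
have Hk k : exists a, j d * f`_k = j a.
  have [lt|le] := ltnP k (size f); first by apply: Hd; rewrite mem_nth.
  by exists 0; rewrite nth_default // mulr0 rmorph0.
have [a Da] := choice Hk; exists d, (\poly_(k < size f) a k); split=> //.
apply/polyP => k; rewrite coef_map coefZ coef_poly /=.
case: ltnP => [_|le]; first by rewrite Da.
by rewrite nth_default // mulr0 rmorph0.
Qed.

Lemma map_io (f : {poly R}) : map_poly io f = map_poly i (map_poly j f).
Proof. exact: map_poly_comp. Qed.

Lemma algebraic_relation w :
  exists2 H : {poly R}, H != 0 & (map_poly io H).[w] = 0.
Proof.
have [f nzf /rootP fw] := algOm w;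
  have [d [F [nzd DF]]] := clear_denominators f.
exists F; last by rewrite map_io DF map_polyZ hornerZ fw mulr0.
apply: contraNneq nzf => F0; move/eqP: DF; rewrite F0 rmorph0 eq_sym scaler_eq0.
by rewrite -(rmorph0 j) (inj_eq j_inj) (negPf nzd).
Qed.

(** As w is nonzero, powers of the variable can be divided out of a relation. The constant term
    certifies nonvanishing: a homomorphism sending w to 0 kills it. *)
Lemma algebraic_relation_coef0 w : w != 0 ->
  exists2 H : {poly R}, H`_0 != 0 & (map_poly io H).[w] = 0.
Proof.
move=> nzw; have [H] := algebraic_relation w.
elim/poly_ind: H => [|H c IH]; first by rewrite eqxx.
have [->|nzc] := eqVneq c 0; last first.
  by exists (H * 'X + c%:P); rewrite // coefD coefMX coefC add0r.
rewrite addr0 mulf_eq0 polyX_eq0 orbF => nzH.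
rewrite rmorphM /= map_polyX hornerMX => /eqP;
  rewrite mulf_eq0 (negPf nzw) orbF.
by move/eqP/(IH nzH).
Qed.

Lemma primitive_element (l : seq Om) :
  exists th, forall w, w \in l -> exists f : {poly E}, w = (map_poly i f).[th].
Proof.
elim: l => [|w l [th IH]]; first by exists 0.
have [p nzp pw] := algOm w; have [q nzq qth] := algOm th.
have [n [[f fw] [g gth]]] := pchar0_PET nzp pw nzq qth charE.
set z := _ - _ in fw gth; exists z => x; rewrite inE => /predU1P[->|/IH[h ->]].
  by exists f.
by exists (h \Po g); rewrite map_comp_poly horner_comp gth.
Qed.

Lemma primitive_element_denom (l : seq Om) : exists th d, d != 0 /\
  forall w, w \in l -> exists F, io d * w = (map_poly io F).[th].
Proof.
have [th Hth] := primitive_element l; exists th.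
elim: l Hth => [|w l IH] Hth; first by exists 1; rewrite oner_eq0.
have [|d [nzd Hd]] := IH; first by move=> x xl; apply: Hth; rewrite inE xl orbT.
have [f Df] := Hth w (mem_head _ _);
  have [e [F [nze DF]]] := clear_denominators f.
exists (d * e); split; first by rewrite mulf_neq0.
move=> x; rewrite inE => /predU1P[->|/Hd[G DG]].
  exists (d *: F); rewrite map_polyZ hornerZ map_io DF map_polyZ hornerZ -Df.
  by rewrite rmorphM mulrA.
exists (e *: G); rewrite map_polyZ hornerZ -DG.
by rewrite rmorphM mulrA [_ * io e]mulrC.
Qed.

(** With h the product of such constant terms, every nonzero w of the list survives wherever h
    does. *)
Lemma nonvanishing_denom (l : seq Om) : exists2 h, h != 0 &
  forall w, w \in l -> w != 0 ->
    exists H : {poly R}, (map_poly io H).[w] = 0 /\ exists c, h = H`_0 * c.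
Proof.
elim: l => [|w l [h nzh IH]]; first by exists 1; rewrite ?oner_eq0.
have [w0|nzw] := eqVneq w 0.
  exists h => // x; rewrite inE => /predU1P[->|]; first by rewrite w0 eqxx.
  exact: IH.
have [H nzH Hw] := algebraic_relation_coef0 nzw.
exists (H`_0 * h); first by rewrite mulf_neq0.
move=> x; rewrite inE => /predU1P[-> _|xl nzx].
  by exists H; split=> //; exists h.
have [G [Gx [c Dc]]] := IH x xl nzx; exists G; split=> //.
by exists (c * H`_0); rewrite Dc mulrC mulrA.
Qed.

(** P is a relation of least size. Pseudo-division leaves a shorter remainder, which must be 0, and
    in characteristic 0 the derivative is a nonzero shorter polynomial, so it does not vanish at
    th. *)
Lemma minimal_relation th : exists P : {poly R},
  [/\ (1 < size P)%N, (map_poly io P).[th] = 0,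
      (map_poly io P^`()).[th] != 0 &
      forall F, (map_poly io F).[th] = 0 ->
        exists k G, lead_coef P ^+ k *: F = G * P].
Proof.
pose Q k := `[< exists2 f : {poly R}, f != 0 /\ (map_poly io f).[th] = 0 & size
  f = k >].
have exQ : exists k, Q k.
  have [H nzH Hth] := algebraic_relation th.
  by exists (size H); apply/asboolP; exists H.
case: (ex_minnP exQ) => _ /asboolP[P [nzP Pth] <-] minP.
have small (f : {poly R}) : (size f < size P)%N ->
  (map_poly io f).[th] = 0 -> f = 0.
  move=> ltf fy; apply/eqP; apply: contraTT ltf => nzf; rewrite -leqNgt.
  by apply: minP; apply/asboolP; exists f.
have P_gt1 : (1 < size P)%N.
  rewrite ltnNge; apply/negP => /size1_polyC DP.
  move: Pth nzP; rewrite DP map_polyC hornerC polyC_eq0 => /eqP.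
  by rewrite io_eq0 => ->.
exists P; split=> // [|F Fth].
  apply/negP => /eqP P'th.
  have : P^`() = 0 by apply: small => //; rewrite lt_size_deriv.
  move/(congr1 (fun f : {poly R} => j f`_(size P).-2))/eqP.
  rewrite coef_deriv coef0 rmorph0 rmorphMn /= prednK; last by move: P_gt1;
    case: (size P).
  rewrite -mulr_natr mulf_eq0; move/pcharf0P: charE => ->.
  rewrite -[(size P).-1]prednK; last by move: P_gt1; case: (size P) => // -[].
  rewrite orbF -(rmorph0 j) (inj_eq j_inj) prednK -?lead_coefE ?lead_coef_eq0
    ?(negPf nzP) //.
  by move: P_gt1; case: (size P) => // -[].
exists (scalp F P), (F %/ P).
rewrite Pdiv.Idomain.divp_eq [F %% P]small ?addr0 ?Pdiv.Idomain.ltn_modp //.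
have /(congr1 (fun f => (map_poly io f).[th])) := Pdiv.Idomain.divp_eq F P.
rewrite rmorphD rmorphM /= map_polyZ hornerZ hornerD hornerM Fth Pth !mulr0
  add0r.
by [].
Qed.

(** The Bezout identity is what later yields a root t of the specialized P: by Hensel's lemma over
    Z, by a Puiseux expansion over Z[X]. *)
Lemma primitive_specialization (l : seq Om) :
  exists (P u v : {poly R}) (D : R),
  [/\ (1 < size P)%N, D != 0, u * P + v * P^`() = D%:P &
      forall (L : fieldType) (phi : {rmorphism R -> L}) (t : L),
        phi D != 0 -> (map_poly phi P).[t] = 0 ->
        exists (S : Om -> Prop) (s : Om -> L),
        [/\ partial_hom S s, phom_good S s l,
            forall r, S (io r) /\ s (io r) = phi r &
            forall w, w \in l -> exists F, phi D * s w = (map_poly phi F).[t]]].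
Proof.
have [th [d [nzd Hd]]] := primitive_element_denom l.
have [h nzh Hh] := nonvanishing_denom l.
have [P [P_gt1 Pth P'th divP]] := minimal_relation th.
have nzP : P != 0 by rewrite -size_poly_gt0 ltnW.
(* A relation H = H1 X + H_0 of the nonzero element P'(th) makes H1(P') P' + H_0 vanish at th, hence
   a multiple of P up to a power of its leading coefficient. This is a Bezout identity for P and
   P'. *)
have [H nzH Hth] := algebraic_relation_coef0 P'th.
have /factor_theorem[H1] : root (H - (H`_0)%:P) 0.
  by rewrite /root !hornerE horner_coef0 subrr.
rewrite subr0 => DH.
have [|k [G DG]] := divP ((H1 \Po P^`()) * P^`() + (H`_0)%:P).
  move: Hth; rewrite -[H in map_poly io H](subrK (H`_0)%:P) DH !rmorphD
    !rmorphM /=.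
  by rewrite map_polyX map_polyC !hornerE map_comp_poly horner_comp.
(* D collects what must survive under phi: the denominator d of the list, the certificate h, the
   leading coefficient of P and the constant of the Bezout identity. *)
pose e := d * h * lead_coef P; pose D := e * (lead_coef P ^+ k * H`_0).
have nzD : D != 0 by rewrite !mulf_neq0 ?expf_neq0 ?lead_coef_eq0.
exists P, (e *: G), (- (e * lead_coef P ^+ k) *: (H1 \Po P^`())), D.
split=> //.
  rewrite -scalerAl -DG scalerA -scalerAl scaleNr scalerDr addrAC subrr add0r.
  by rewrite -mul_polyC -polyCM /D mulrA.
move=> L phi t nzphi Pt.
have [nzpl] : phi (lead_coef P) != 0 /\ phi d != 0 /\ phi h != 0.
  by move: nzphi; rewrite /D /e !rmorphM !mulf_eq0 !negb_or =>
    /andP[/andP[/andP[-> ->] ->]].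
move=> [nzpd nzph].
have van F : (map_poly io F).[th] = 0 -> (map_poly phi F).[t] = 0.
  move=> /divP[m [G' /(congr1 (fun f => (map_poly phi f).[t]))]].
  rewrite map_polyZ hornerZ rmorphM hornerM /= Pt mulr0 => /eqP.
  by rewrite mulf_eq0 rmorphXn expf_eq0 (negPf nzpl) andbF => /eqP.
(* S is R[1/D][th], and s sends F(th) / D^k to F(t) / phi(D)^k; the value 0 outside S is a dummy. *)
pose rep w (Fk : {poly R} * nat) := io D ^+ Fk.2 * w = (map_poly io Fk.1).[th].
pose val (Fk : {poly R} * nat) := (map_poly phi Fk.1).[t] / phi D ^+ Fk.2.
pose S w := exists Fk, rep w Fk.
pose s w := if pselect (S w) is left ex then val (projT1 (cid ex)) else 0.
have uniq_rep w Fk Gm : rep w Fk -> rep w Gm -> val Fk = val Gm.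
  case: Fk Gm => [F a] [F' b]; rewrite /rep /val /= => DF DF'.
  have : (map_poly phi (D ^+ b *: F - D ^+ a *: F')).[t] = 0.
    apply: van; rewrite rmorphB /= !map_polyZ hornerD hornerN !hornerZ -DF -DF'
      !rmorphXn.
    by rewrite !mulrA [_ ^+ b * _]mulrC subrr.
  rewrite rmorphB /= !map_polyZ hornerD hornerN !hornerZ !rmorphXn => /eqP.
  rewrite subr_eq0 => /eqP eFF'; apply/eqP; rewrite eqr_div ?expf_neq0 //.
  by rewrite mulrC eFF' mulrC.
have sE w Fk : rep w Fk -> S w /\ s w = val Fk.
  move=> wF; have Sw : S w by exists Fk.
  split=> //; rewrite /s; case: pselect => // ex; case: (cid ex) => Gm wG /=.
  exact: uniq_rep wG wF.
have nzDk a : phi D ^+ a != 0 by rewrite expf_neq0.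
have homS : partial_hom S s.
  have [S1 s1] : S 1 /\ s 1 = val (1, 0%N).
    by apply: sE; rewrite /rep /= rmorph1 hornerC mul1r.
  split=> //; first by rewrite s1 /val /= rmorph1 hornerC divr1.
  - move=> x y [[F a] xF] [[F' b] yF]; have [_ ->] := sE _ _ xF;
    have [_ ->] := sE _ _ yF.
    have [|Sxy ->] := sE (x - y) (D ^+ b *: F - D ^+ a *: F', (a + b)%N).
    + move: xF yF; rewrite /rep /= => xF yF.
      rewrite rmorphB /= !map_polyZ hornerD hornerN !hornerZ -xF -yF !rmorphXn
        exprD /=; ring.
    split=> //; rewrite /val /= rmorphB /= !map_polyZ hornerD hornerN !hornerZ
      !rmorphXn exprD /=.
    by field; rewrite !nzDk.
  - move=> x y [[F a] xF] [[F' b] yF]; have [_ ->] := sE _ _ xF;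
    have [_ ->] := sE _ _ yF.
    have [|Sxy ->] := sE (x * y) (F * F', (a + b)%N).
    + move: xF yF; rewrite /rep /= => xF yF.
      rewrite [map_poly io _]rmorphM hornerM -xF -yF exprD /=; ring.
    split=> //; rewrite /val /= [map_poly phi _]rmorphM hornerM exprD /=.
    by field; rewrite !nzDk.
have Sio r : S (io r) /\ s (io r) = phi r.
  have [|Sr ->] := sE (io r) (r%:P, 0%N);
    first by rewrite /rep /= mul1r map_polyC hornerC.
  by rewrite /val /= map_polyC hornerC divr1.
have Sl w : w \in l -> exists F, rep w (F, 1%N).
  move=> /Hd[F DF]; exists ((h * lead_coef P * (lead_coef P ^+ k * H`_0)) *: F).
  rewrite /rep /= map_polyZ hornerZ -DF expr1 [RHS]mulrA -rmorphM;
    congr (io _ * _).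
  by rewrite /D /e; ring.
have Shorner w (F : {poly R}) : S w ->
    S (map_poly io F).[w] /\ s (map_poly io F).[w] = (map_poly phi F).[s w].
  move=> Sw; elim/poly_ind: F => [|F c [SF sF]].
    by rewrite !rmorph0 !horner0; apply: phom0 homS.
  have [Sc sc] := Sio c; have [SM sM] := phomM homS SF Sw.
  have [SD sD] := phomD homS SM Sc.
  by rewrite !rmorphD !rmorphM /= !map_polyX !map_polyC !hornerMXaddC sD sM sc
    sF.
exists S, s; split=> // [w wl|w wl]; last first.
  have [F wF] := Sl w wl; have [_ ->] := sE _ _ wF; exists F.
  by rewrite /val /= expr1 mulrCA divff // mulr1.
have [F wF] := Sl w wl; have [Sw _] := sE _ _ wF; split=> // nzw.
(* If s w were 0, phi would kill the constant term of K, which divides h. *)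
have [K [Kw [c Dc]]] := Hh w wl nzw; apply/eqP => sw0.
have [_] := Shorner w K Sw; have [_ s0] := phom0 homS.
rewrite Kw s0 sw0 horner_coef0 coef_map /= => K0.
by move: nzph; rewrite Dc rmorphM /= -K0 mul0r eqxx.
Qed.

End PrimitiveElement.

(** * Newton-Puiseux expansions *)

Section Puiseux.
Variable k : closedFieldType.
Hypothesis chark : [pchar k] =i pred0.
Implicit Types (a c D : {poly k}) (Q U V : {poly {poly k}}).

Lemma dvdXP a : reflect (a.[0] = 0) ('X %| a)%R.
Proof. by rewrite -['X]subr0 -polyC0 dvdp_XsubCl; apply: rootP. Qed.

Lemma dvdXnSP n a :
  reflect (exists2 b : {poly k}, a = b * 'X^n & b.[0] = 0) ('X^(n.+1) %| a)%R.
Proof.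
apply: (iffP idP) => [/dvdpP[b ->]|[b -> /dvdXP/dvdpP[d ->]]].
  by exists (b * 'X); rewrite -?mulrA -?exprS // hornerMX mulr0.
by rewrite -mulrA -exprS dvdp_mulIr.
Qed.

Lemma comp_poly_Xn_eq0 e a : (0 < e)%N -> (a \Po 'X^e == 0) = (a == 0).
Proof. by move=> e0; rewrite comp_poly_eq0 // size_polyXn ltnS. Qed.

(** Elements of [{poly {poly k}}] are read as polynomials in T over k[X]; this is reduction modulo
    X. *)
Definition reduction Q : {poly k} := map_poly (horner_eval 0) Q.

Lemma coef_reduction Q i : (reduction Q)`_i = (Q`_i).[0].
Proof. by rewrite coef_map. Qed.

Lemma reduction_comp Q U : reduction (Q \Po U) = reduction Q \Po reduction U.
Proof. exact: map_comp_poly. Qed.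

Definition ramify e Q := map_poly (comp_poly 'X^e) Q.

Definition vanish_order (f : {poly k}) m := (forall i, (i < m)%N ->
  f`_i = 0) /\ f`_m != 0.

(* Over the field k(X) this says that Q is separable, when [D] is nonzero. *)
Definition separated D Q := exists U V, U * Q + V * Q^`() = D%:P.

(* Here Q is a polynomial in T over k[X]: after the ramification X -> X^e, the
   truncated series [c] approximates a root of Q well enough for the remainder
   to be a simple root modulo X. *)
Definition expandable Q := exists e c r N Q',
  [/\ (0 < e)%N, ramify e Q \Po (c%:P + 'X^r *: 'X) = 'X^N *: Q',
      (Q'`_0).[0] = 0 & (Q'`_1).[0] != 0].

(** X-adic Newton iteration, one coefficient at a time: al is the solution of h(0) + Q_1(0) al = 0,
    which cancels the next term of Q(c). *)
Lemma newton_approx Q B : (Q`_0).[0] = 0 -> (Q`_1).[0] != 0 ->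
  exists2 c, c.[0] = 0 & 'X^B %| Q.[c].
Proof.
move=> Q0 Q1.
have horner0E U c : c.[0] = 0 -> (U.[c]).[0] = (U`_0).[0].
  move=> c0; rewrite -[LHS]/(horner_eval 0 U.[c]) -horner_map /= [horner_eval 0
    c]c0.
  by rewrite [LHS]horner_coef0 coef_map.
suff IH n : exists2 c, c.[0] = 0 & 'X^(n.+1) %| Q.[c].
  have [c c0 dv] := IH B; exists c => //.
  by apply: dvdp_trans dv; rewrite dvdp_exp2l.
elim: n => [|n [c c0 /dvdpP[h Dh]]].
  by exists 0; rewrite ?horner0 // expr1; apply/dvdXP;
    rewrite horner0E ?horner0.
pose al := - (h.[0] / (Q`_1).[0]).
have [g Dg] := horner_taylor2 Q c (al%:P * 'X^(n.+1)).
exists (c + al%:P * 'X^(n.+1)).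
  by rewrite hornerD hornerM hornerXn expr0n /= mulr0 addr0.
apply/dvdXnSP; exists (h + Q^`().[c] * al%:P + g * al%:P ^+ 2 * 'X^(n.+1)).
  by rewrite Dg Dh; ring.
rewrite !hornerD !hornerM hornerXn expr0n mulr0 addr0 hornerC.
by rewrite horner0E // coef_deriv mulr1n /al mulrN mulrCA divff // mulr1 subrr.
Qed.

Lemma coef_shift Q c i : (Q \Po ('X + c%:P))`_i = (Q^`N(i)).[c].
Proof.
elim/poly_ind: Q i => [|Q d IHQ] i.
  by rewrite comp_poly0 coef0 linear0 horner0.
rewrite comp_polyD comp_polyC comp_polyM comp_polyX mulrDr !coefD coefMX coefMC
  coefC.
case: i => [|i]; rewrite /= IHQ.
  by rewrite !nderivn0 hornerMXaddC add0r.
by rewrite IHQ addr0 nderivnMXaddC hornerD hornerMX.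
Qed.

Lemma reduction_shift Q c : reduction (Q \Po ('X + c%:P)) = reduction Q \Po ('X
  + (c.[0])%:P).
Proof. by rewrite reduction_comp /reduction rmorphD /= map_polyX map_polyC. Qed.

Lemma separated_shift D Q c : separated D Q -> separated D (Q \Po ('X + c%:P)).
Proof.
move=> [U [V bez]]; exists (U \Po ('X + c%:P)), (V \Po ('X + c%:P)).
rewrite deriv_comp derivD derivX derivC addr0 mulr1 -!rmorphM -rmorphD /= bez.
by rewrite comp_polyC.
Qed.

Lemma separated_ramify D Q e : separated D Q ->
  separated (D \Po 'X^e) (ramify e Q).
Proof.
move=> [U [V bez]]; exists (ramify e U), (ramify e V).
by rewrite /ramify deriv_map -!rmorphM -rmorphD /= bez map_polyC.
Qed.

(** Differentiating the relation produces a factor X^r, by which the Bezout identity is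
    multiplied. *)
Lemma separated_scale D Q Q1 r N :
  Q \Po ('X^r *: 'X) = 'X^N *: Q1 -> separated D Q -> separated ('X^r * D) Q1.
Proof.
move=> DQ [U [V bez]].
have DQ' : 'X^r *: (Q^`() \Po ('X^r *: 'X)) = 'X^N *: Q1^`().
  by rewrite -derivZ -DQ deriv_comp derivZ derivX mulrC -scalerAl mul1r.
exists ('X^r *: ('X^N *: (U \Po ('X^r *: 'X)))), ('X^N *: (V \Po ('X^r *: 'X))).
have /(congr1 (fun f : {poly {poly k}} => 'X^r *: (f \Po ('X^r *: 'X)))) := bez.
rewrite rmorphD !rmorphM /= DQ scalerDr [_ *: (_ * (Q^`() \Po _))]scalerAr DQ'.
rewrite comp_polyC -!mul_polyC => <-; ring.
Qed.

Lemma expandable_shift Q c : expandable (Q \Po ('X + c%:P)) -> expandable Q.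
Proof.
move=> [e [c' [r [N [Q' [e0 DQ Q0 Q1]]]]]].
exists e, (c' + (c \Po 'X^e)), r, N, Q'; split=> //; rewrite -DQ.
rewrite /ramify map_comp_poly -comp_polyA [map_poly _ ('X + _)]rmorphD /=
  map_polyX map_polyC /=.
by rewrite comp_polyD comp_polyX comp_polyC polyCD addrAC.
Qed.

Lemma expandable_ramify Q e : (0 < e)%N -> expandable (ramify e Q) ->
  expandable Q.
Proof.
move=> e0 [e' [c' [r [N [Q' [e'0 DQ Q0 Q1]]]]]].
exists (e' * e)%N, c', r, N, Q'; split; rewrite ?muln_gt0 ?e'0 // -DQ.
congr (_ \Po _); rewrite /ramify -map_poly_comp; apply: eq_map_poly => a /=.
by rewrite -comp_polyA comp_Xn_poly -exprM.
Qed.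

Lemma expandable_scale Q Q1 r N : Q \Po ('X^r *: 'X) = 'X^N *: Q1 ->
  expandable Q1 -> expandable Q.
Proof.
move=> DQ [e [c [r' [N' [Q' [e0 DQ1 Q0' Q1']]]]]].
exists e, ('X^(e * r) * c), (e * r + r')%N, (e * N + N')%N, Q'; split=> //.
have := congr1 (fun f => ramify e f \Po (c%:P + 'X^r' *: 'X)) DQ.
rewrite /ramify map_comp_poly !map_polyZ map_polyX -/(ramify e Q) -/(ramify e
  Q1) /=.
rewrite !comp_Xn_poly -!exprM comp_polyZ DQ1 scalerA -exprD => <-.
rewrite -comp_polyA comp_polyZ comp_polyX scalerDr scalerA -exprD.
by rewrite polyCM mul_polyC.
Qed.

Lemma coef_XsubC_exp (c : k) m : (('X - c%:P) ^+ m.+1)`_m = - c *+ m.+1.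
Proof.
have lead n : (('X - c%:P) ^+ n)`_n = 1.
  by have /eqP := monic_exp n (monicXsubC c); rewrite lead_coefE size_exp_XsubC.
elim: m => [|m IHm]; first by rewrite expr1 coefB coefX coefC sub0r.
by rewrite exprSr mulrBr coefB coefMX coefMC /= IHm lead mul1r [RHS]mulrSr.
Qed.

(* If c had multiplicity m, then f would be a multiple of (X - c)^m, and the
   vanishing of the coefficient of X^(m-1) would force c = 0. *)
Lemma root_lower_order (f : {poly k}) m i :
    size f = m.+1 -> (i < m)%N -> f`_i != 0 -> f`_m.-1 = 0 ->
  exists (c : k) n, [/\ (0 < n)%N, (n < m)%N & vanish_order (f \Po ('X + c%:P))
    n].
Proof.
move=> szf ltim nzi fm0.
have /closed_rootP[c fc] : size f != 1%N by rewrite szf; case: (m) ltim.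
pose g := f \Po ('X + c%:P).
have szg : size g = m.+1 by rewrite size_comp_poly2 ?size_XaddC.
have nzg : g`_m != 0.
  by rewrite -[m]/(m.+1.-1) -szg -lead_coefE lead_coef_eq0 -size_poly_gt0 szg.
have ex : exists n, g`_n != 0 by exists m.
case: (ex_minnP ex) => n nzn minn.
have n_gt0 : (0 < n)%N.
  case: n nzn {minn} => // /eqP[]; rewrite -horner_coef0 horner_comp !hornerE.
  exact/rootP.
exists c, n; split=> //; last first.
  by split=> // l lt; apply/eqP; apply: contraLR lt; rewrite -leqNgt;
    apply: minn.
rewrite ltn_neqAle minn // andbT; apply/eqP => nm.
have Dg : g = g`_m *: 'X^m.
  apply/polyP => l; rewrite coefZ coefXn; case: ltngtP => [ltlm|ltml|->];
    last by rewrite mulr1.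
    by rewrite mulr0; apply/eqP; apply: contraLR ltlm; rewrite -leqNgt -nm;
      apply: minn.
  by rewrite mulr0 nth_default // szg.
have Df : f = g`_m *: ('X - c%:P) ^+ m.
  rewrite -[LHS](comp_polyXaddC_K f c) -/g Dg comp_polyZ comp_Xn_poly.
  by rewrite coefZ coefXn eqxx mulr1.
have m0 : (0 < m)%N by apply: leq_ltn_trans ltim.
have c0 : c = 0.
  move/eqP: fm0; rewrite Df coefZ mulf_eq0 (negPf nzg) /=.
  have -> : (('X - c%:P) ^+ m)`_m.-1 = - c *+ m.
    by rewrite -[m in _ ^+ m]prednK // coef_XsubC_exp prednK.
  rewrite -mulr_natr mulf_eq0 oppr_eq0; move/pcharf0P: chark => ->.
  by case: (m) m0 => // ? _; rewrite orbF => /eqP.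
move: nzi; rewrite Df c0 subr0 coefZ coefXn; case: ltngtP ltim => //.
by rewrite mulr0 eqxx.
Qed.

Lemma coef_comp_scale Q a i : (Q \Po (a *: 'X))`_i = a ^+ i * Q`_i.
Proof.
elim/poly_ind: Q i => [|Q d IHQ] i; first by rewrite comp_poly0 !coef0 mulr0.
rewrite comp_polyD comp_polyC comp_polyM comp_polyX -scalerAr coefD coefZ
  coefMX.
rewrite !coefD coefMX !coefC; case: i => [|i] /=;
  first by rewrite mulr0 !add0r mul1r.
by rewrite IHQ !addr0 exprS mulrA.
Qed.

Lemma scaled_poly Q N : (forall i, 'X^N %| Q`_i) -> exists Q1, Q = 'X^N *: Q1.
Proof.
move=> dv; exists (\poly_(i < size Q) (Q`_i %/ 'X^N)); apply/polyP => i.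
rewrite coefZ coef_poly; case: ltnP => [_|le]; first by rewrite mulrC divpK.
by rewrite mulr0 nth_default.
Qed.

(** The X-adic valuation, with an arbitrary value at 0. *)
Lemma X_valuation : exists v : {poly k} -> nat, forall a, a != 0 ->
  exists2 b, a = b * 'X^(v a) & b.[0] != 0.
Proof.
have ex a : exists n, a != 0 -> exists2 b, a = b * 'X^n & b.[0] != 0.
  have [n [b nzb Da]] := multiplicity_XsubC a 0; exists n => nza.
  by exists b; [rewrite {1}Da subr0 | move: nzb; rewrite nza].
by have [v Hv] := choice ex; exists v.
Qed.

Lemma mulXn_cancel b n a c : 'X^n * a = 'X^(n + b) * c -> a = 'X^b * c.
Proof.
rewrite exprD -mulrA => /mulfI; apply.
by rewrite -size_poly_gt0 size_polyXn.
Qed.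

(* The minimum of [v(Q_i) / (m - i)] is r / e for an index i0, with e = m - i0
   and r = v(Q_i0).  It is not attained at m - 1: Q_0 and Q_1 are not both
   divisible by X^B because D is not. *)
Lemma newton_slope Q U V D m B : (1 < m)%N -> vanish_order (reduction Q) m ->
    U * Q + V * Q^`() = D%:P -> ~~ ('X^B %| D) -> 'X^B %| Q`_m.-1 ->
  exists e r N Q1 i,
  [/\ (0 < e)%N, ramify e Q \Po ('X^r *: 'X) = 'X^N *: Q1, size (reduction Q1)
    = m.+1,
      (i < m)%N /\ (reduction Q1)`_i != 0 & (reduction Q1)`_m.-1 = 0].
Proof.
move=> m1 [Q0 Qm] bez nDB dvB; have [v Hv] := X_valuation.
have {}Q0 i : (i < m)%N -> (Q`_i).[0] = 0 by move=> /Q0; rewrite coef_reduction.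
have [i1 lt1 ndv1] : exists2 i, (i < m.-1)%N & ~~ ('X^B %| Q`_i).
  have DE : D = U`_0 * Q`_0 + V`_0 * Q`_1.
    move/(congr1 (fun f : {poly {poly k}} => f`_0)): bez.
    by rewrite coefD !coef0M coef_deriv coefC mulr1n.
  have [d0|] := boolP ('X^B %| Q`_0); last by exists 0%N => //;
    case: (m) m1 => [|[]].
  exists 1%N; last first.
    by apply: contra nDB => d1; rewrite DE dvdp_add // dvdp_mull.
  (* For m = 2 the coefficient Q_1 is the one assumed divisible by X^B, so D would be divisible as
     well. *)
  case: (m) m1 dvB => [|[|[|n]]] //= _ d1; case/negP: nDB.
  by rewrite DE dvdp_add // dvdp_mull.
have lt1m : (i1 < m)%N by apply: leq_trans lt1 (leq_pred _).
have nz1 : Q`_i1 != 0 by apply: contraNneq ndv1 => ->; rewrite dvdp0.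
pose w (i : nat) : nat := v (Q`_i)%R.
have v1B : (w i1 < B)%N.
  rewrite ltnNge; apply: contra ndv1 => leB; have [b -> _] := Hv _ nz1.
  by rewrite dvdp_mull // dvdp_exp2l.
pose sl (i : 'I_m) : rat := (w i)%:R / (m - i)%:R.
have [i0 nz0 min0] := arg_minP sl (nz1 : (fun i : 'I_m =>
  Q`_i != 0) (Ordinal lt1m)).
have {sl}min0 i : (i < m)%N -> Q`_i != 0 ->
  (w i0 * (m - i) <= w i * (m - i0))%N.
  move=> lti nzi; have := min0 (Ordinal lti) nzi; rewrite /sl /=.
  rewrite ler_pdivrMr ?ltr0n ?subn_gt0 // mulrAC ler_pdivlMr ?ltr0n ?subn_gt0
    //.
  by rewrite -!natrM ler_nat.
set r := w i0 in min0; pose e := (m - i0)%N.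
have e0 : (0 < e)%N by rewrite subn_gt0.
have [b0 Db0 nzb0] := Hv _ nz0; rewrite -/(w i0) -/r in Db0.
have r0 : (0 < r)%N.
  rewrite lt0n; apply: contraNneq nzb0 => r0.
  by have := Q0 i0 (ltn_ord i0); rewrite Db0 r0 mulr1 => ->.
have coefE i : (ramify e Q \Po ('X^r *: 'X))`_i = 'X^(r * i) * (Q`_i \Po 'X^e).
  by rewrite coef_comp_scale -exprM /ramify coef_map.
have compX a n : (a * 'X^n) \Po 'X^e = 'X^(e * n) * (a \Po 'X^e).
  by rewrite comp_polyM comp_Xn_poly -exprM mulrC.
have dvi i : 'X^(r * m) %| 'X^(r * i) * (Q`_i \Po 'X^e).
  have [lti|lei] := ltnP i m;
    last by rewrite dvdp_mulr // dvdp_exp2l // leq_mul2l lei orbT.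
  have [->|nzi] := eqVneq Q`_i 0; first by rewrite comp_poly0 mulr0 dvdp0.
  have [b -> _] := Hv _ nzi;
    rewrite compX mulrA -exprD dvdp_mulr // dvdp_exp2l //.
  by have := min0 i lti nzi; rewrite -/e mulnBr leq_subLR [(w i * e)%N]mulnC.
have [Q1 DQ1] : exists Q1, ramify e Q \Po ('X^r *: 'X) = 'X^(r * m) *: Q1.
  by apply: scaled_poly => i; rewrite coefE.
have Q1E i : 'X^(r * i) * (Q`_i \Po 'X^e) = 'X^(r * m) * Q1`_i.
  by rewrite -coefE DQ1 coefZ.
have X0 n a : (0 < n)%N -> ('X^n * a).[0] = 0.
  by case: n => // n _; rewrite hornerM hornerXn expr0n mul0r.
have comp0 a : (a \Po 'X^e).[0] = a.[0] by rewrite horner_comp hornerXn expr0n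
  gtn_eqF.
exists e, r, (r * m)%N, Q1, i0; split=> //; last 2 first.
- split=> //; rewrite coef_reduction; have := Q1E i0;
  rewrite {1}Db0 compX mulrA -exprD.
  have -> : (r * i0 + e * r = r * m)%N by rewrite /e; have := ltn_ord i0; nia.
  rewrite -[(r * m)%N in RHS]addn0 => /mulXn_cancel; rewrite mul1r => <-.
  by rewrite comp0.
- rewrite coef_reduction; have /dvdpP[b Db] := dvB.
  have := Q1E m.-1; rewrite Db compX mulrA -exprD.
  (* Minimality against i1 gives r <= v(Q_i1) e < e B, so the coefficient of index m - 1 lies
     strictly above the Newton line. *)
  have rB : (r < e * B)%N.
    have := min0 _ lt1m nz1; rewrite -/e => le1.
    apply: (@leq_ltn_trans (w i1 * e)); last by rewrite mulnC ltn_pmul2l.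
    by apply: leq_trans le1; rewrite leq_pmulr // subn_gt0.
  have -> : (r * m.-1 + e * B = r * m + (e * B - r))%N.
    by rewrite -{2}[m]prednK ?(ltnW m1) //; nia.
  by move=> /esym/mulXn_cancel ->; rewrite X0 // subn_gt0.
have cm : (Q1`_m).[0] != 0.
  have := Q1E m; rewrite -[(r * m)%N in RHS]addn0 => /mulXn_cancel;
    rewrite mul1r => <-.
  by rewrite comp0 -coef_reduction.
apply/eqP; rewrite eqn_leq; apply/andP; split; last first.
  by rewrite ltnNge; apply/negP => le; move: cm;
    rewrite -coef_reduction nth_default ?eqxx.
apply/leq_sizeP => i lti; rewrite coef_reduction; have := Q1E i.
have -> : (r * i = r * m + r * (i - m))%N by rewrite -mulnDr subnKC // ltnW.
rewrite exprD -mulrA -[(r * m)%N in RHS]addn0 => /mulXn_cancel;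
  rewrite mul1r => <-.
by rewrite X0 // muln_gt0 r0 subn_gt0.
Qed.

(** Induction on the multiplicity m of the root 0 modulo X. A shift makes Q_(m-1) divisible by a
    high power of X, the Newton slope is then rescaled away, and the new reduction has a root of
    multiplicity between 1 and m - 1, which is moved to 0. *)
Lemma puiseux m D Q : (0 < m)%N -> D != 0 -> separated D Q ->
  vanish_order (reduction Q) m -> expandable Q.
Proof.
elim/ltn_ind: m D Q => m IH D Q m0 nzD sepQ ordQ.
have [m1|m1] := leqP m 1.
  have {IH m0 m1} m1 : m = 1%N by apply/eqP; rewrite eqn_leq m1.
  have [ord0 ord1] := ordQ; rewrite m1 coef_reduction in ord1.
  exists 1%N, 0, 0%N, 0%N, Q; split=> //;
    last by rewrite -coef_reduction ord0 ?m1.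
  rewrite /ramify expr1 !scale1r add0r comp_polyXr.
  by rewrite (eq_map_poly (comp_polyXr (R:=k))) map_poly_id.
pose B := size D.
have nDB : ~~ ('X^B %| D).
  by apply/negP => /(dvdp_leq nzD); rewrite size_polyXn ltnn.
have [ord0 ordm] := ordQ.
(* The shift c is an approximate root of the divided derivative of order m - 1. That root is simple
   modulo X because its linear coefficient is m Q_m and the characteristic is 0. *)
have [||c c0 dvB] := @newton_approx Q^`N(m.-1) B.
- by rewrite coef_nderivn addn0 binn mulr1n -coef_reduction ord0 // prednK.
- rewrite coef_nderivn addn1 prednK // -{2}[m]prednK // binSn prednK //.
  rewrite -mulr_natr hornerM -polyC_natr hornerC mulf_neq0 // -?coef_reduction
    //.
  by move/pcharf0P: chark => ->; rewrite -lt0n.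
rewrite -coef_shift in dvB; apply: (@expandable_shift Q c).
have ord2 : vanish_order (reduction (Q \Po ('X + c%:P))) m.
  by rewrite reduction_shift c0 addr0 comp_polyXr.
have sep2 := separated_shift c sepQ;
  move: (Q \Po _) dvB ord2 sep2 => {ord0 ordm ordQ sepQ}Q.
move=> dvB ordQ sepQ; have [U [V bez]] := sepQ.
have [e [r [N [Q1 [i [e0 DQ1 szQ1 [lti nzi] Qm0]]]]]] := newton_slope m1 ordQ
  bez nDB dvB.
have [d [n [n0 ltn ordn]]] := root_lower_order szQ1 lti nzi Qm0.
apply: (expandable_ramify e0); apply: (expandable_scale DQ1);
  apply: (@expandable_shift _ d%:P).
apply: IH ltn ('X^r * (D \Po 'X^e)) _ n0 _ _ _.
- by rewrite mulf_neq0 ?comp_poly_Xn_eq0 // -size_poly_gt0 size_polyXn.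
- by apply: separated_shift; apply: separated_scale DQ1 _;
  apply: separated_ramify.
- by rewrite reduction_shift hornerC.
Qed.

Lemma comp_scale_inj r : injective (fun Q => Q \Po ('X^r *: 'X)).
Proof.
move=> Q1 Q2 /polyP eqQ; apply/polyP => i; have := eqQ i.
rewrite !coef_comp_scale -exprM => /mulfI; apply.
by rewrite -size_poly_gt0 size_polyXn.
Qed.

Lemma homogenize Q r n : (size Q <= n)%N ->
  exists Q1, Q1 \Po ('X^r *: 'X) = 'X^(r * n) *: Q.
Proof.
move=> leQ; exists (\poly_(i < n) (Q`_i * 'X^(r * (n - i)))); apply/polyP => i.
rewrite coef_comp_scale coefZ coef_poly -exprM; case: ltnP => [lt|le];
  last first.
  by rewrite nth_default ?mulr0 // (leq_trans leQ).
by rewrite mulrCA -exprD -mulnDr subnKC ?(ltnW lt) // mulrC.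
Qed.

(** Undoing T -> X^r T puts powers of X in the denominators of the Bezout coefficients; [homogenize]
    clears them, at the cost of the factor X^M. *)
Lemma separated_unscale D Q Q1 r N :
  Q1 \Po ('X^r *: 'X) = 'X^N *: Q -> separated D Q ->
    exists M, separated ('X^M * D) Q1.
Proof.
move=> DQ [U [V bez]]; pose n := maxn (size U) (size V).
have [U1 DU] := homogenize r (leq_maxl _ _ : size U <= n)%N.
have [V1 DV] := homogenize r (leq_maxr _ _ : size V <= n)%N.
have DQ' : 'X^r *: (Q1^`() \Po ('X^r *: 'X)) = 'X^N *: Q^`().
  by rewrite -derivZ -DQ deriv_comp derivZ derivX mulrC -scalerAl mul1r.
exists (r * n + N)%N, U1, ('X^r *: V1); apply: (@comp_scale_inj r) => /=.
rewrite comp_polyD !comp_polyM comp_polyZ comp_polyC DQ DU DV.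
set W := Q1^`() \Po _ in DQ' *.
have -> : 'X^r *: ('X^(r * n) *: V) * W = 'X^(r * n) *: (V * ('X^r *: W)).
  by rewrite -!mul_polyC; ring.
have -> : ('X^(r * n + N) * D)%:P = 'X^(r * n) *: ('X^N *: (U * Q + V * Q^`())).
  by rewrite bez scalerA -exprD polyCM mul_polyC.
by rewrite DQ' -!mul_polyC; ring.
Qed.

(* Roots of Q may have a pole at X = 0; for J large enough their multiples by
   X^J, which are the roots of Q1, all vanish there. *)
Lemma unit_lead_scale D Q : (1 < size Q)%N -> D != 0 -> separated D Q ->
  exists Q1 J N D1, [/\ Q1 \Po ('X^J *: 'X) = 'X^N *: Q, D1 != 0, separated D1
    Q1 &
    vanish_order (reduction Q1) (size Q).-1].
Proof.
move=> Q1 nzD sepQ; pose d := (size Q).-1.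
have d0 : (0 < d)%N by rewrite /d; case: (size Q) Q1 => [|[]].
have szQ : size Q = d.+1 by rewrite prednK // ltnW.
have nzl : Q`_d != 0 by rewrite -lead_coefE lead_coef_eq0 -size_poly_gt0 szQ.
have [v Hv] := X_valuation; have [b Db nzb] := Hv _ nzl; set n := v _ in Db.
(* Here n is the valuation of the leading coefficient, and J exceeds it so that every exponent J (d
   - i) - n with i < d is positive. *)
pose J := n.+1.
pose F := \poly_(i < d.+1) (if i == d then b else Q`_i * 'X^(J * (d - i) - n)).
have DF : F \Po ('X^J *: 'X) = 'X^(J * d - n) *: Q.
  apply/polyP => i; rewrite coef_comp_scale coefZ coef_poly -exprM;
    case: ltnP => [lt|le]; last first.
    by rewrite nth_default ?mulr0 // szQ.
  case: eqP => [->|/eqP ne].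
    by rewrite Db mulrCA -exprD subnK ?[b * _]mulrC // /J mulSn; nia.
  rewrite mulrCA -exprD [RHS]mulrC; congr (_ * 'X^_).
  by rewrite /J; move: ne lt; nia.
have [M sepF] := separated_unscale DF sepQ.
exists F, J, (J * d - n)%N, ('X^M * D); split=> //.
  by rewrite mulf_neq0 // -size_poly_gt0 size_polyXn.
split=> [i lt|]; rewrite coef_reduction coef_poly; last by rewrite ltnSn eqxx.
rewrite ltnS (ltnW lt) ltn_eqF // hornerM hornerXn expr0n.
have -> : (J * (d - i) - n == 0)%N = false by rewrite /J; move: lt;
  rewrite -/d; nia.
by rewrite mulr0.
Qed.

End Puiseux.

(** * Roots in p-adic fields *)

Section PartialHomRing.
Variables (Om L : fieldType) (S : Om -> Prop) (s : Om -> L).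

(** The proof is an argument so that the subring structure can be attached to the predicate; s then
    becomes a genuine ring morphism, which can be mapped over polynomials. *)
Definition phom_dom of partial_hom S s : {pred Om} := fun x => `[< S x >].

Variable homS : partial_hom S s.

Fact phom_dom_subring : subring_closed (phom_dom homS).
Proof.
have [S1 _ B M] := homS; split; first exact/asboolP.
  by move=> x y /asboolP Sx /asboolP Sy; apply/asboolP; have [] := B _ _ Sx Sy.
by move=> x y /asboolP Sx /asboolP Sy; apply/asboolP; have [] := M _ _ Sx Sy.
Qed.

HB.instance Definition _ :=
  GRing.isSubringClosed.Build Om (phom_dom homS) phom_dom_subring.

Definition phom_ring := {x : Om | x \in phom_dom homS}.
HB.instance Definition _ := SubType.copy phom_ring {x : Om | x \in phom_dom
  homS}.
HB.instance Definition _ := [Choice of phom_ring by <:].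
HB.instance Definition _ := [SubChoice_isSubComNzRing of phom_ring by <:].

Definition phom_fun (x : phom_ring) : L := s (val x).

Lemma phom_valP (x : phom_ring) : S (val x).
Proof. exact: asboolW (valP x). Qed.

Fact phom_fun_zmod_morphism : zmod_morphism phom_fun.
Proof.
by have [_ _ B _] := homS => x y; have [_] := B _ _ (phom_valP x) (phom_valP y).
Qed.

Fact phom_fun_monoid_morphism : monoid_morphism phom_fun.
Proof.
have [_ s1 _ M] := homS; split=> // x y.
by have [_] := M _ _ (phom_valP x) (phom_valP y).
Qed.

HB.instance Definition _ :=
  GRing.isZmodMorphism.Build phom_ring L phom_fun phom_fun_zmod_morphism.
HB.instance Definition _ :=
  GRing.isMonoidMorphism.Build phom_ring L phom_fun phom_fun_monoid_morphism.

Lemma phom_lift (f : {poly Om}) : (forall i, S f`_i) ->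
  exists f' : {poly phom_ring}, map_poly val f' = f.
Proof.
move=> Sf; have ex i : exists a : phom_ring, val a = f`_i.
  by exists (Sub f`_i (asboolT (Sf i) : f`_i \in phom_dom homS)); rewrite SubK.
have [a Da] := choice ex; exists (\poly_(i < size f) a i).
apply/polyP => i; rewrite coef_map coef_poly /=; case: ltnP => [_|le];
  first exact: Da.
by rewrite nth_default.
Qed.

Lemma phom_lift2 (Q : {poly {poly Om}}) : (forall i j, S (Q`_i)`_j) ->
  exists Q' : {poly {poly phom_ring}}, map_poly (map_poly val) Q' = Q.
Proof.
move=> SQ; have [a Da] := choice (fun i => phom_lift (SQ i)).
exists (\poly_(i < size Q) a i).
apply/polyP => i; rewrite coef_map coef_poly /=; case: ltnP => [_|le];
  first exact: Da.
by rewrite nth_default // -[sval]/val map_poly0.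
Qed.

End PartialHomRing.

Lemma fraction_denom (R : idomainType) (x : {fraction R}) :
  exists a b : R, b != 0 /\ tofrac b * x = tofrac a.
Proof.
elim/quotW: x => x; exists (frac x).1, (frac x).2; split;
  first exact: denom_ratioP.
rewrite -[_ * _]/(FracField.mul _ _) !piE; apply/eqmodP.
rewrite /= FracField.equivfE /FracField.mulf !numden_Ratio ?mulf_neq0 ?oner_eq0
  ?denom_ratioP //.
by rewrite mulr1 mul1r.
Qed.

(** The resulting countability of Q(X) gives access to [countable_algebraic_closure]. *)
Definition fraction_rep (R : countIdomainType) (x : {fraction R}) : R * R :=
  frac (repr x).

Lemma fraction_repK (R : countIdomainType) :
  cancel (@fraction_rep R) (fun xy => (\pi_{fraction R} (Ratio xy.1 xy.2))%qT).
Proof. by move=> x; rewrite /fraction_rep Ratio_numden reprK. Qed.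

HB.instance Definition _ (R : countIdomainType) :=
  Countable.copy {fraction R} (can_type (@fraction_repK R)).

Lemma coord0_natr (q : prime_nat) : coord 0 (q%:R : padic_int q) = 0.
Proof. by apply/eqP; rewrite coord_natr_eq0 expn1. Qed.

Lemma large_int_unit (q : prime_nat) (D : int) :
  D != 0 -> (`|D| < q)%N -> coord 0 (D%:~R : padic_int q) != 0.
Proof.
move=> nzD ltq; rewrite coord_intr_eq0 expn1; apply/negP => /dvdn_leq.
by rewrite absz_gt0 nzD => /(_ isT); rewrite leqNgt ltq.
Qed.

Lemma algC_to_padic (l : seq algC) N : exists2 q : prime_nat, (N < q)%N &
  exists (S : algC -> Prop) (s : algC -> padic q), partial_hom S s /\
    forall w, w \in l -> S w /\ exists a : padic_int q, s w = tofrac a.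
Proof.
have [||||P [u [v [D [P1 nzD bez HP]]]]] := @primitive_specialization int rat
  algC intr ratr _ _ _ _ l.
- exact: intr_inj.
- by move=> x; exists (numq x), (denq x); rewrite denq_neq0 /= numqE mulrC.
- exact: pchar_num.
- move=> w; have [p [Dp mon_p] rootp] := minCpolyP w.
  by exists p; rewrite ?monic_neq0 // rootp.
have [q [ltq [b Pb]]] := int_poly_padic_root (N + `|D|) P1 bez nzD.
exists q; first by apply: leq_ltn_trans ltq; rewrite leq_addr.
have D0 : coord 0 (D%:~R : padic_int q) != 0.
  by apply: large_int_unit => //; apply: leq_ltn_trans ltq; rewrite leq_addl.
have fracZ (f : {poly int}) : (map_poly (intr : int ->
  padic q) f).[tofrac b] = tofrac (map_poly intr f).[b].
  rewrite -horner_map /= -map_poly_comp; congr (_.[_]);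
    apply: eq_map_poly => n /=.
  by rewrite rmorph_int.
have UD : (D%:~R : padic_int q) \is a GRing.unit by rewrite padic_int_unitE.
have fracD : D%:~R = tofrac D%:~R :> padic q by rewrite rmorph_int.
have [||S [s [homS goodS _ HF]]] := HP (padic q) intr (tofrac b).
- rewrite /= fracD tofrac_eq0; apply: contraNneq D0 => ->.
  by rewrite rmorph0.
- by rewrite fracZ Pb rmorph0.
exists S, s; split=> // w wl; have [Sw _] := goodS w wl; split=> //.
have [F DF] := HF w wl; exists ((D%:~R)^-1 * (map_poly intr F).[b]).
rewrite rmorphM /= -fracZ -DF /= fracD mulrA -rmorphM /= mulVr //.
by rewrite rmorph1 mul1r.
Qed.

Definition coefs2 (F : fieldType) (Q : {poly {poly F}}) : seq F :=
  flatten [seq polyseq a | a <- polyseq Q].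

Lemma mem_coefs2 (F : fieldType) (Q : {poly {poly F}}) i j :
  (Q`_i)`_j != 0 -> (Q`_i)`_j \in coefs2 Q.
Proof.
move=> nz; apply/flattenP; exists (polyseq Q`_i).
  apply/mapP; exists Q`_i => //; apply: mem_nth; rewrite ltnNge.
  by apply: contraNN nz => le; rewrite [Q`_i]nth_default // coef0.
by apply: mem_nth; rewrite ltnNge; apply: contraNN nz => le;
  rewrite nth_default.
Qed.

Definition eval_at (K : fieldType) (x : K) : {rmorphism {poly int} -> K} :=
  horner_eval x \o map_poly intr.

(** Modulo q, putting X = q amounts to putting X = 0, where T = 0 is a simple root; w shows that the
    linear coefficient is a unit. *)
Lemma integral_poly_root (q : prime_nat) (F : {poly {poly (padic q)}})
    (w : padic_int q) :
    (forall i j, exists a : padic_int q, (F`_i)`_j = tofrac a) ->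
    (F`_0)`_0 = 0 -> (F`_1)`_0 * tofrac w = 1 ->
  exists b : padic q, (map_poly (horner_eval q%:R) F).[b] = 0.
Proof.
move=> intF F0 F1.
pose a i j := projT1 (cid (intF i j)).
have Da i j : (F`_i)`_j = tofrac (a i j) := projT2 (cid (intF i j)).
pose A i := \poly_(j < size F`_i) a i j.
have AE i : map_poly tofrac (A i) = F`_i.
  apply/polyP => j; rewrite coef_map coef_poly; case: ltnP => [_|le] /=;
    first by rewrite Da.
  by rewrite nth_default // rmorph0.
pose G := \poly_(i < size F) (A i).[q%:R].
have GE : map_poly tofrac G = map_poly (horner_eval q%:R) F.
  apply/polyP => i; rewrite !coef_map coef_poly /= /horner_eval;
    case: ltnP => [_|le].
    by rewrite -AE -(rmorph_nat tofrac) horner_map.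
  by rewrite rmorph0 [F`_i]nth_default // horner0.
have coordA i : coord 0 G`_i = coord 0 (A i)`_0.
  rewrite coef_poly; case: ltnP => [_|le].
    rewrite -horner_coef0 -!horner_map /=; congr (_.[_]).
    by rewrite coord0_natr rmorph0.
  rewrite /A [F`_i]nth_default // size_poly0; congr coord.
  by rewrite coef_poly.
have A0 i : tofrac (A i)`_0 = (F`_i)`_0 by rewrite -AE coef_map.
have [||b Gb] := @hensel q G 0 w.
- rewrite horner_coef0 coordA; have /eqP := A0 0%N.
  by rewrite F0 tofrac_eq0 => /eqP->; rewrite rmorph0.
- rewrite horner_coef0 coef_deriv mulr1n rmorphM /= coordA -[RHS](rmorph1
  (coord 0)).
  rewrite -[LHS](rmorphM (coord 0)); congr (coord 0 _); apply/eqP;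
    rewrite -tofrac_eq rmorphM rmorph1 /= A0.
  by rewrite mulrC F1.
by exists (tofrac b); rewrite -GE horner_map Gb rmorph0.
Qed.

Lemma padic_prime_neq0 (q : prime_nat) : (q%:R : padic q) != 0.
Proof.
rewrite -(rmorph_nat tofrac) tofrac_eq0; apply/eqP => q0.
have /eqP : coord 1 (q%:R : padic_int q) = 0 by rewrite q0 rmorph0.
rewrite coord_natr_eq0 => /dvdn_leq;
  rewrite prime_gt0 ?prime_natP // => /(_ isT).
have : (q ^ 1 < q ^ 2)%N by rewrite ltn_exp2l // prime_gt1 ?prime_natP.
by rewrite expn1 ltnNge => /negPf->.
Qed.

Lemma eval_atXn (K : fieldType) (x : K) j : eval_at x 'X^j = x ^+ j.
Proof. by rewrite /= /horner_eval map_polyXn hornerXn. Qed.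

Lemma eval_atE (K : fieldType) (x : K) f : eval_at x f = (map_poly intr f).[x].
Proof. by []. Qed.

Lemma tofrac_horner_int (R : idomainType) (f : {poly int}) (x : R) :
  tofrac (map_poly intr f).[x] = (map_poly intr f).[tofrac x].
Proof.
rewrite -horner_map -map_poly_comp; congr (_.[_]); apply: eq_map_poly => n /=.
by rewrite rmorph_int.
Qed.

(** D2(q^e) is congruent to D2(0) modulo q, and q is too large to divide D2(0). *)
Lemma eval_at_prime_power_neq0 (q : prime_nat) e (D D2 : {poly int}) j :
    (0 < e)%N -> D = D2 * 'X^j -> D2.[0] != 0 -> (`|D2.[0]| < q)%N ->
  eval_at (q%:R ^+ e : padic q) D != 0.
Proof.
move=> e0 -> nz0 ltq; have y0 := expf_neq0 e (padic_prime_neq0 q).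
rewrite rmorphM eval_atXn; apply: mulf_neq0; last exact: expf_neq0.
have -> : q%:R ^+ e = tofrac (q%:R ^+ e) :> padic q by rewrite rmorphXn
  rmorph_nat.
rewrite eval_atE -tofrac_horner_int.
rewrite tofrac_eq0; apply: contraNneq (large_int_unit nz0 ltq) => D20.
have := congr1 (coord 0) D20; rewrite rmorph0 -horner_map /= rmorphXn /=.
rewrite coord0_natr expr0n gtn_eqF // => <-.
by rewrite !horner_coef0 !coef_map.
Qed.

(** The identities over k descend to A by injectivity of f and are then evaluated in K. A root b of
    Q' at X = x gives the root c(x) + x^r b of Q at X = x^e, and division by x^(e J) gives a root of
    P. *)
Lemma expansion_root (A : comNzRingType) (k K : fieldType)
    (f : {rmorphism A -> k}) (g : {rmorphism A -> K}) (P : {poly {poly int}})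
    (Q Q' : {poly {poly A}}) (c : {poly A}) e J r N1 N2 (x b : K) :
    injective f -> x != 0 ->
    map_poly (map_poly f) Q \Po ('X^J *: 'X)
      = 'X^N1 *: map_poly (map_poly intr) P ->
    map_poly (comp_poly 'X^e) (map_poly (map_poly f) Q)
      \Po ((map_poly f c)%:P + 'X^r *: 'X) = 'X^N2 *: map_poly (map_poly f) Q'
        ->
    (map_poly (horner_eval x) (map_poly (map_poly g) Q')).[b] = 0 ->
  exists t, (map_poly (eval_at (x ^+ e)) P).[t] = 0.
Proof.
move=> f_inj nzx eqPQ eqQ Qb.
pose VV : {rmorphism {poly {poly A}} ->
  {poly {poly k}}} := map_poly (map_poly f).
have VV_inj : injective VV.
  by apply: map_inj_poly; [apply: map_inj_poly;
    rewrite ?rmorph0 | rewrite rmorph0].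
pose PA : {poly {poly A}} := map_poly (map_poly intr) P.
have DPA : map_poly (map_poly f) PA = map_poly (map_poly intr) P.
  rewrite /PA -map_poly_comp; apply: eq_map_poly => a /=.
  by rewrite -map_poly_comp; apply: eq_map_poly => n /=; rewrite rmorph_int.
have eq1 : Q \Po ('X^J *: 'X) = 'X^N1 *: PA.
  apply: VV_inj; rewrite /VV /= map_comp_poly !map_polyZ /= !map_polyXn
    map_polyX.
  by rewrite eqPQ DPA.
have eq2 : map_poly (comp_poly 'X^e) Q \Po (c%:P + 'X^r *: 'X) = 'X^N2 *: Q'.
  apply: VV_inj; rewrite /VV /= map_comp_poly rmorphD /= !map_polyZ /=
    !map_polyXn.
  rewrite map_polyX map_polyC /= -eqQ -!map_poly_comp.
  congr (_ \Po _); apply: eq_map_poly => a /=.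
  by rewrite map_comp_poly map_polyXn.
pose ev (y : K) : {rmorphism {poly A} -> K} := horner_eval y \o map_poly g.
have evXn y n : ev y 'X^n = y ^+ n by rewrite /ev /= /horner_eval map_polyXn
  hornerXn.
have evQ' : (map_poly (ev x) Q').[b] = 0 by rewrite -Qb -map_poly_comp.
pose y := x ^+ e; pose t1 := ev x c + x ^+ r * b.
have y0 : y != 0 by rewrite expf_neq0.
have Qt1 : (map_poly (ev y) Q).[t1] = 0.
  have := congr1 (fun f => (map_poly (ev x) f).[b]) eq2.
  rewrite map_polyZ hornerZ evQ' mulr0 map_comp_poly horner_comp => <-.
  rewrite rmorphD hornerD /= map_polyZ map_polyX map_polyC hornerC hornerZ
    hornerX evXn.
  rewrite -map_poly_comp; congr (_.[_]); apply: eq_map_poly => a /=.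
  by rewrite /horner_eval map_comp_poly map_polyXn horner_comp hornerXn.
exists (t1 / y ^+ J).
have := congr1 (fun f => (map_poly (ev y) f).[t1 / y ^+ J]) eq1.
rewrite map_comp_poly horner_comp !map_polyZ map_polyX !hornerZ hornerX !evXn.
rewrite mulrCA divff ?expf_neq0 // mulr1 Qt1 => /esym/eqP.
rewrite mulf_eq0 expf_eq0 (negPf y0) andbF /= => /eqP <-.
rewrite -map_poly_comp; congr (_.[_]); apply: eq_map_poly => a /=.
rewrite /horner_eval -map_poly_comp; congr (_.[_]); apply: eq_map_poly => n /=.
by rewrite rmorph_int.
Qed.

Lemma puiseux_root (P u v : {poly {poly int}}) (D : {poly int}) N :
    (1 < size P)%N -> D != 0 -> u * P + v * P^`() = D%:P ->
  exists2 q : prime_nat, (N < q)%N & exists e (t : padic q),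
    [/\ (0 < e)%N, eval_at (q%:R ^+ e : padic q) D != 0 &
        (map_poly (eval_at (q%:R ^+ e : padic q)) P).[t] = 0].
Proof.
move=> P1 nzD bez.
have intC_inj : injective (map_poly (intr : int -> algC)).
  by apply: map_inj_poly => //; apply: intr_inj.
pose C : {rmorphism {poly {poly int}} ->
  {poly {poly algC}}} := map_poly (map_poly intr).
have sepP : separated (map_poly intr D) (C P).
  by exists (C u), (C v);
    rewrite /C /= deriv_map -!rmorphM -rmorphD bez /= map_polyC.
have szC : size (C P) = size P by rewrite size_map_inj_poly // rmorph0.
have nzDc : map_poly (intr : int -> algC) D != 0.
  by rewrite -(rmorph0 (map_poly intr)) (inj_eq intC_inj).
have [|Q [J [N1 [D1 [DQ nzD1 sepQ ordQ]]]]] := unit_lead_scale _ nzDc sepP.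
  by rewrite szC.
have [|e [c [r [N2 [Q' [e0 DQ' Q0' Q1']]]]]] := puiseux (@pchar_num algC) _
  nzD1 sepQ ordQ.
  by rewrite szC; case: (size P) P1 => [|[]].
have [j [D2 nzD2 DD]] := multiplicity_XsubC D 0.
rewrite nzD /= subr0 -[~~ _]/(D2.[0] != 0) in nzD2 DD.
pose al := (Q'`_1).[0].
(* Including the inverse of al makes the image of al a unit of Z_q. *)
pose l := coefs2 Q ++ c ++ coefs2 Q' ++ [:: al^-1].
have [q ltq [S [s [homS Sl]]]] := algC_to_padic l (N + `|D2.[0]|).
exists q; first by apply: leq_ltn_trans ltq; rewrite leq_addr.
have [S0 s0] := phom0 homS.
have S2 (F : {poly {poly algC}}) : {subset coefs2 F <= l} ->
  forall i j', S (F`_i)`_j'.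
  move=> sub i j'; have [->//|nz] := eqVneq ((F`_i)`_j') 0.
  by have [] := Sl _ (sub _ (mem_coefs2 nz)).
have [QA DQA] := phom_lift2 homS (S2 Q (fun x xl =>
  ltac:(by rewrite mem_cat xl))).
have [QA' DQA'] := phom_lift2 homS (S2 Q' (fun x xl =>
  ltac:(by rewrite !mem_cat xl ?orbT))).
have [i|cA DcA] := phom_lift homS (f := c).
  have [lt|le] := ltnP i (size c); last by rewrite nth_default.
  by have [] // := Sl c`_i _; rewrite !mem_cat mem_nth ?orbT.
pose sA : {rmorphism phom_ring homS -> padic q} := phom_fun (homS := homS).
have sQ' i j' : ((map_poly (map_poly sA) QA')`_i)`_j' = s (Q'`_i)`_j'.
  by rewrite -DQA' !coef_map.
have [Sal [w Dw]] : S al^-1 /\ exists w : padic_int q, s al^-1 = tofrac w.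
  by apply: Sl; rewrite !mem_cat mem_head !orbT.
have Sa : S al by rewrite /al horner_coef0; apply: S2 => y yl;
  rewrite !mem_cat yl ?orbT.
have [||| b Db] := @integral_poly_root q (map_poly (map_poly sA) QA') w.
- move=> i j'; rewrite sQ'; have [->|nz] := eqVneq (Q'`_i)`_j' 0.
    by exists 0; rewrite s0 rmorph0.
  by have [] := Sl (Q'`_i)`_j' _; rewrite // !mem_cat mem_coefs2 ?orbT.
- by rewrite sQ' -horner_coef0 Q0' s0.
- rewrite sQ' -horner_coef0 -/al -Dw; have [_ <-] := phomM homS Sa Sal.
  by rewrite divff //; have [] := homS.
rewrite -DQA in DQ DQ'; rewrite -DQA' -DcA in DQ'.
have [t Pt] := expansion_root val_inj (padic_prime_neq0 q) DQ DQ' Db.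
exists e, t; split=> //; apply: (eval_at_prime_power_neq0 e0 DD nzD2).
by apply: leq_ltn_trans ltq; rewrite leq_addl.
Qed.

(** * Transfer from transcendental elements to powers of primes *)

Definition transcendental (K : fieldType) (x : K) :=
  forall g : {poly int}, (map_poly intr g).[x] = 0 -> g = 0.

(** Reversing the coefficients turns a relation for the inverse into one for x. *)
Lemma transcendentalV (K : fieldType) (x : K) :
  transcendental x -> transcendental x^-1.
Proof.
move=> trx g gx0.
have nzx : x != 0.
  apply/eqP => x0; have := trx 'X; rewrite map_polyX hornerX => /(_ x0)/eqP.
  by rewrite polyX_eq0.
pose n := size g; pose h := \poly_(i < n) g`_(n - i.+1).
have h0 : h = 0.
  apply: trx; apply/eqP; apply: contraTT isT => nz.
  have : (map_poly intr h).[x] * x = x ^+ n * (map_poly intr g).[x^-1].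
    rewrite (@horner_coef_wide _ n) ?(leq_trans (size_poly _ _)) ?size_poly //.
    rewrite (@horner_coef_wide _ n) ?size_poly // mulr_suml mulr_sumr.
    rewrite [RHS](reindex_inj rev_ord_inj); apply: eq_bigr => i _ /=.
    rewrite !coef_map coef_poly ltn_ord /= -mulrA -exprSr mulrCA; congr (_ * _).
    rewrite exprVn; apply: (canRL (mulfK _)); first exact: expf_neq0.
    by rewrite -exprD subnKC.
  by move/eqP; rewrite gx0 mulr0 mulf_eq0 (negPf nz) (negPf nzx).
apply/polyP => i; rewrite coef0; have [lt|le] := ltnP i n;
  last by rewrite nth_default.
have /polyP/(_ (n - i.+1)%N) := h0; rewrite coef_poly coef0.
have -> : (n - i.+1 < n)%N by lia.
by rewrite subnSK // subKn // ltnW.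
Qed.

Lemma polyX_transcendental (K : fieldType)
    (i : {rmorphism {fraction {poly int}} -> K}) :
  transcendental (i (tofrac 'X)).
Proof.
move=> g; set io : {rmorphism {poly int} -> K} := i \o @FracField.tofrac _.
have -> : (map_poly intr g).[i (tofrac 'X)] = io g.
  rewrite -[g in RHS]comp_polyXr /comp_poly -horner_map -map_poly_comp.
  congr (_.[_]); apply: eq_map_poly => n /=.
  by rewrite -[n in RHS]intz !rmorph_int.
by move/eqP; rewrite fmorph_eq0 tofrac_eq0 => /eqP.
Qed.

(** The truth of f passes from x to X or to 1/X, as b dictates, and X is then sent to q^e. *)
Lemma existential_transfer (K : fieldType) (f : formula 1) (x : K) (b : bool) N
  :
    existential f -> transcendental x -> holds f [tuple x] ->
  exists2 q : prime_nat, (N < q)%N & exists2 e, (0 < e)%N &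
    holds f [tuple if b then q%:R ^+ e else (q%:R ^+ e)^-1 : padic q].
Proof.
move=> exf trx fx.
have [Om [i algi]] := countable_algebraic_closure {fraction {poly int}}.
pose io : {rmorphism {poly int} -> Om} := i \o @FracField.tofrac _.
pose X := io 'X.
have trX : transcendental X by apply: polyX_transcendental.
have natE n : (n%:R == 0 :> {fraction {poly int}}) = (n == 0)%N.
  by rewrite -(rmorph_nat tofrac) tofrac_eq0 -polyC_natr polyC_eq0 pnatr_eq0.
have natOm_inj : injective (fun n : nat => n%:R : Om).
  move=> m n /eqP; wlog le_mn : m n / (m <= n)%N.
    by move=> W /[dup]; case/orP: (leq_total m n) => le e1 e2; [|apply/esym];
      apply: W => //; rewrite eq_sym.
  rewrite eq_sym -subr_eq0 -natrB // -(rmorph_nat i) fmorph_eq0 natE subn_eq0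
    => le_nm.
  by apply/eqP; rewrite eqn_leq le_mn.
pose w := if b then X else X^-1.
have trw : transcendental w by rewrite /w; case: (b);
  last exact: transcendentalV.
have [a nza Ha] := existential_specialize natOm_inj exf fx.
(* Since x is transcendental it has no nontrivial relation to preserve, and since w is, the nonzero
   polynomial a does not vanish at w. *)
have fw : holds f [tuple w].
  apply: Ha => [g /trx ->|]; first exact: rmorph0.
  by apply: contraNneq nza => /trw ->; apply/eqP; apply: rmorph0.
have [l Hl] := existential_phom exf fw.
(* With X and its inverse both in the list, the image of 1/X is the inverse of q^e. *)
have [||||P [u [v [D [P1 nzD bez HP]]]]] :=
  @primitive_specialization _ _ _ (@FracField.tofrac {poly int}) i _ _ _ _ [::
    X, X^-1, w & l].
- by move=> g h /eqP; rewrite tofrac_eq => /eqP.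
- exact: fraction_denom.
- exact/pcharf0P.
- by move=> z; apply/integral_algebraic.
have [q ltq [e [t [e0 nzDq Pt]]]] := puiseux_root N P1 nzD bez.
exists q => //; exists e => //.
have [S [s [homS goodS Sio _]]] := HP _ _ _ nzDq Pt.
have [SX sX] : S X /\ s X = eval_at (q%:R ^+ e) 'X := Sio 'X.
have {}sX : s X = q%:R ^+ e by rewrite sX -['X]expr1 eval_atXn.
have [SV _] : S X^-1 /\ (X^-1 != 0 -> s X^-1 != 0) by apply: goodS;
  rewrite !inE eqxx orbT.
have nzX : X != 0.
  apply/eqP => X0; have := trX 'X; rewrite map_polyX hornerX => /(_ X0)/eqP.
  by rewrite polyX_eq0.
have sV : s X^-1 = (q%:R ^+ e)^-1.
  have y0 := expf_neq0 e (padic_prime_neq0 q).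
  have [_ s1 _ _] := homS; have [_] := phomM homS SX SV.
  by rewrite divff // s1 sX => /esym/(canRL (mulKf y0)); rewrite mulr1.
have -> : [tuple if b then q%:R ^+ e else (q%:R ^+ e)^-1 : padic q] = map_tuple
  s [tuple w].
  by apply: val_inj; rewrite /= /w; case: (b); rewrite ?sX ?sV.
apply: Hl homS _ _ => [j|z zl].
  by rewrite [j]ord1 /w; case: (b).
by apply: goodS; rewrite !inE zl !orbT.
Qed.

Lemma liouville_transcendental_padic p :
  transcendental (tofrac (liouville p) : padic p).
Proof.
move=> g /eqP; rewrite -tofrac_horner_int tofrac_eq0 => /eqP.
exact: liouville_transcendental.
Qed.

Lemma inv_nonunit_notin_padic_int_set (p : prime_nat) (x : padic_int p) :
  x != 0 -> coord 0 x = 0 -> ~ padic_int_set p (tofrac x)^-1.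
Proof.
move=> nzx x0 [y _ Dy].
have /eqP : tofrac (x * y) = 1 :> padic p.
  by rewrite rmorphM /= Dy divff // tofrac_eq0.
rewrite -(rmorph1 tofrac) tofrac_eq => /eqP /(congr1 (coord 0)).
by rewrite rmorphM /= x0 mul0r rmorph1 => /eqP; rewrite eq_sym oner_eq0.
Qed.

Lemma liouville_neq0 p : liouville p != 0.
Proof.
apply/eqP => l0; have := @liouville_transcendental p 'X.
by rewrite map_polyX hornerX => /(_ l0)/eqP; rewrite polyX_eq0.
Qed.

Lemma padic_int_set_not_definable N (f : formula 1) :
    existential f \/ universal f ->
  ~ forall p : prime_nat, (N <= p)%N ->
    padic_int_set p = defined_set (padic p) f.
Proof.
move=> ex_un Zf.
have memZ (p : prime_nat) z : (N <= p)%N ->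
  padic_int_set p z <-> holds f [tuple z].
  by move=> leN; rewrite (Zf p leN).
have [p' ltNp prp] := prime_above N; pose p := PrimeNat prp.
have leNp : (N <= p)%N := ltnW ltNp.
pose x : padic p := tofrac (liouville p).
have trx : transcendental x := @liouville_transcendental_padic p.
have qpow (q : prime_nat) e : q%:R ^+ e = tofrac (q%:R ^+ e) :> padic q.
  by rewrite rmorphXn rmorph_nat.
case: ex_un => [exf|/universal_negation[g exg Hg]].
  have fx : holds f [tuple x] by apply/(memZ p x leNp); exists (liouville p).
  have [q ltNq [e e0 fq]] := existential_transfer false N exf trx fx.
  move/(memZ q _ (ltnW ltNq)): fq; rewrite qpow;
    apply: inv_nonunit_notin_padic_int_set.
    by rewrite -tofrac_eq0 -qpow expf_neq0 // padic_prime_neq0.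
  by rewrite rmorphXn /= coord0_natr expr0n gtn_eqF.
(* The negation g needs a transcendental element outside Z_p: the inverse of one divisible by p. *)
have gx : holds g [tuple x^-1].
  apply/Hg => /(memZ p _ leNp); apply: inv_nonunit_notin_padic_int_set.
    exact: liouville_neq0.
  exact: coord0_liouville.
have [q ltNq [e e0 /Hg]] := existential_transfer true N exg (transcendentalV
  trx) gx.
by case; apply/(memZ q _ (ltnW ltNq)); rewrite qpow; eexists.
Qed.

Theorem theorem1p5 :
  (~ exists f : formula 1,
       (existential f \/ universal f) /\
       forall p : prime_nat, padic_int_set p = defined_set (padic p) f) /\
  (forall N : nat, (0 < N)%N ->
     ~ exists f : formula 1,
         (existential f \/ universal f) /\
         forall p : prime_nat, (N <= p)%N ->
           padic_int_set p = defined_set (padic p) f).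
Proof.
split=> [[f [ex_un Zf]]|N _ [f [ex_un Zf]]].
  by apply: (@padic_int_set_not_definable 0 f ex_un) => p _.
exact: padic_int_set_not_definable ex_un Zf.
Qed.
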